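(* Let $\gamma>1$. For any finite $c_1,c_2>0$ there exists $c_3>0$ such that the following holds. Let $n,d\ge1$ be sufficiently large integers with $d\le 2^{\sqrt{\log n}}$ and $n\le 2^{d^{0.99}}$, and let $k$ be an integer with $1\le k\le\frac{\log\log d}{2\log\log\log d}$. If $\mathsf{ANNS}^{\gamma}_{d,n}$ has a $k$-round randomized cell-probing scheme with table size $s\le n^{c_1}$ and word size $w\le d^{c_2}$ such that every query is correctly answered within $t$ total cell-probes in $k$ rounds with probability at least $7/8$, then $t>\frac{c_3}{k}(\log_\gamma d)^{1/k}$.
   Context: $\mathsf{ANNS}^{\gamma}_{d,n}$ (approximate nearest neighbor search in Hamming space): a database $B\subseteq\{0,1\}^d$ with $|B|=n$ is preprocessed into a table; given a query $x\in\{0,1\}^d$, the answer must be a point $z\in B$ with $\mathrm{dist}(x,z)\le\gamma\cdot\mathrm{dist}(x,y)$ for all $y\in B$, where $\mathrm{dist}$ is Hamming distance. In the cell-probe model, each database is stored as a table of $s$ cells of $w$ bits each. A $k$-round cell-probing algorithm is given by lookup functions $L_1,\dots,L_k$ and an output function: in round $i$, $L_i$ maps the query and the addresses and contents of all cells probed in earlier rounds to a list of $t_i$ addresses probed in parallel; the output function maps the query and all probed addresses/contents to the answer; $t=\sum_i t_i$. In a randomized cell-probing scheme the table is a deterministic function of the database and the algorithm may use private random bits. Logarithms are binary. *)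

(* Defs.v *)
From HB Require Import structures.
From mathcomp Require Import all_boot all_order all_algebra.
From mathcomp Require Import reals exp.

Set Implicit Arguments.
Unset Strict Implicit.
Unset Printing Implicit Defensive.

Import Order.TTheory GRing.Theory Num.Theory.
Local Open Scope ring_scope.

Definition logb (R : realType) (b x : R) : R := ln x / ln b.
Definition log2 (R : realType) (x : R) : R := logb 2 x.

Definition cube (d : nat) : finType := d.-tuple bool.

Definition hamming (d : nat) (x y : cube d) : nat :=
  #|[set i : 'I_d | tnth x i != tnth y i]|.

Definition anns_correct (R : realType) (gamma : R) (d : nat)
    (B : {set cube d}) (x z : cube d) : bool :=
  (z \in B) &&
  [forall y in B, (hamming x z)%:R <= gamma * (hamming x y)%:R].

Definition contents (s w : nat) : Type := {ffun 'I_s -> w.-tuple bool}.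

(* The addresses and contents of the cells probed so far, in order of probing.
   The rounds are concatenated: the numbers of probes per round are fixed, so
   the sequence can be cut back into rounds. *)
Definition transcript (s w : nat) : Type := seq ('I_s * w.-tuple bool).

(* [ts i] is the number of cells probed in parallel in round [i]. *)
Record algorithm (d s w k : nat) (ts : 'I_k -> nat) := Algorithm {
  lookup : forall i : 'I_k, cube d -> transcript s w -> (ts i).-tuple 'I_s;
  output : cube d -> transcript s w -> cube d
}.

Definition run_round (d s w k : nat) (ts : 'I_k -> nat)
    (A : algorithm d s w ts) (T : contents s w) (x : cube d)
    (h : transcript s w) (i : 'I_k) : transcript s w :=
  h ++ [seq (a, T a) | a <- lookup A i x h].

(* [enum 'I_k] lists the rounds in increasing order. *)
Definition answer (d s w k : nat) (ts : 'I_k -> nat)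
    (A : algorithm d s w ts) (T : contents s w) (x : cube d) : cube d :=
  output A x (foldl (run_round A T x) [::] (enum 'I_k)).

(* The table does not depend on the random seed. The seed ranges over an
   arbitrary finite probability space; m uniform random bits are the special
   case [seed = m.-tuple bool]. No generality is lost for an unbounded supply
   of bits, as there are finitely many behaviours of a deterministic algorithm
   for given d, s, w and ts. *)
Record randomized_scheme (R : realType) (d s w k : nat) (ts : 'I_k -> nat) :=
  RandomizedScheme {
    table : {set cube d} -> contents s w;
    seed : finType;
    seed_prob : seed -> R;
    seed_prob_ge0 : forall r, 0 <= seed_prob r;
    seed_prob_sum1 : \sum_(r : seed) seed_prob r = 1;
    algo : seed -> algorithm d s w ts
  }.

Arguments seed_prob {R d s w k ts} _ _.
Arguments algo {R d s w k ts} _ _.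

Definition success_prob (R : realType) (gamma : R) (d s w k : nat)
    (ts : 'I_k -> nat) (S : randomized_scheme R d s w ts)
    (B : {set cube d}) (x : cube d) : R :=
  \sum_(r : seed S | anns_correct gamma B x (answer (algo S r) (table S B) x))
     seed_prob S r.

Definition anns_has_randomized_scheme (R : realType) (gamma : R)
    (d n s w k t : nat) : Prop :=
  exists (ts : 'I_k -> nat) (S : randomized_scheme R d s w ts),
    (\sum_(i < k) ts i)%N = t /\
    forall B : {set cube d}, #|B| = n ->
    forall x : cube d, 7 / 8 <= success_prob gamma S B x.

(* Main.v *)
(** Take a tree in which every node has [q] children and map its leaves to the
    cube by a concatenation of codes whose lengths decrease geometrically from
    the root down; a leaf that leaves the query path higher up is then more than
    [gamma] times farther from the query, so an answer to ANNS is an answer to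
    longest prefix match. The depth available is proportional to [log d].

    The hard instances are built recursively, one level for each round. A query
    is a list of [p] blocks [(c, x')], where [c] is a child and [x'] a query of
    the previous level. The database fixes a random position [i], follows the
    first [i] blocks of the query, and then puts independent databases of the
    previous level below all [q] children. A random bit is attached to every
    leaf, and the algorithm has to find the bit of the leaf on the query path.

    One round is eliminated as follows. The addresses probed in the first round
    are a message of [t log s] bits about [p] independent blocks, hence carry
    about [t log s / p] bits about the block at the random position [i]. So
    about [n ^ (1 / 4k)] sample messages suffice for the algorithm, which may
    choose the blocks after [i], to hit one of them. The contents of the cells
    in these samples are few bits about [q = n ^ (1 / 2k)] independent databases,
    so they can be fixed in advance, the databases below the other children
    being chosen to fit. Losing [O(1 / k)] in the success probability requires
    [p] to be of order [k ^ 2 t], so [k] rounds can be eliminated unless the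
    product of the numbers [k ^ 2 t_i] exceeds the depth; without any probes the
    bit is correct with probability [1 / 2]. *)
Require Import Defs.
From HB Require Import structures.
From mathcomp Require Import all_boot all_order all_algebra.
From mathcomp Require boolp.
From mathcomp Require Import reals sequences exp.
From mathcomp Require Import ring lra zify.

Set Implicit Arguments.
Unset Strict Implicit.
Unset Printing Implicit Defensive.

Import Order.TTheory GRing.Theory Num.Theory.
Local Open Scope ring_scope.

(** * Averages over finite types *)

Section Average.
Context {R : realType}.

(** On an empty type this is [0], which is why some lemmas ask for an inhabitant and others split on
    [#|T|]. *)
Definition avg (T : finType) (f : T -> R) : R := #|T|%:R^-1 * \sum_x f x.

Lemma eq_avg (T : finType) (f g : T -> R) : f =1 g -> avg f = avg g.
Proof. by move=> fg; rewrite /avg; under eq_bigr do rewrite fg. Qed.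

Lemma avg_sum (T : finType) I (r : seq I) (P : pred I) (f : I -> T -> R) :
  avg (fun x => \sum_(i <- r | P i) f i x) = \sum_(i <- r | P i) avg (f i).
Proof. by rewrite /avg exchange_big /= mulr_sumr. Qed.

Lemma avgD (T : finType) (f g : T -> R) :
  avg (fun x => f x + g x) = avg f + avg g.
Proof. by rewrite /avg big_split /= mulrDr. Qed.

Lemma avgZl (T : finType) a (f : T -> R) : avg (fun x => a * f x) = a * avg f.
Proof. by rewrite /avg -mulr_sumr mulrCA. Qed.

Lemma avgZr (T : finType) a (f : T -> R) : avg (fun x => f x * a) = avg f * a.
Proof. by rewrite /avg -mulr_suml mulrA. Qed.

Lemma avgB (T : finType) (f g : T -> R) :
  avg (fun x => f x - g x) = avg f - avg g.
Proof. by rewrite /avg sumrB mulrBr. Qed.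

Lemma le_avg (T : finType) (f g : T -> R) :
  (forall x, f x <= g x) -> avg f <= avg g.
Proof.
by move=> fg; rewrite /avg ler_wpM2l ?invr_ge0 ?ler0n // ler_sum.
Qed.

Lemma avg_ge0 (T : finType) (f : T -> R) : (forall x, 0 <= f x) -> 0 <= avg f.
Proof.
by move=> f0; rewrite /avg mulr_ge0 ?invr_ge0 ?ler0n ?sumr_ge0.
Qed.

Lemma avg_cst (T : finType) (x0 : T) (a : R) : avg (fun _ : T => a) = a.
Proof.
rewrite /avg sumr_const -[X in _ * X]mulr_natl mulrA mulVf ?mul1r // pnatr_eq0 -lt0n.
by apply/card_gt0P; exists x0.
Qed.

Lemma exchange_avg (T U : finType) (f : T -> U -> R) :
  avg (fun x => avg (f x)) = avg (fun y => avg (f^~ y)).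
Proof. by rewrite {1}/avg -avg_sum -avgZl. Qed.

Lemma avg_pair (T U : finType) (f : T * U -> R) :
  avg f = avg (fun x => avg (fun y => f (x, y))).
Proof.
rewrite /avg -mulr_sumr pair_bigA card_prod natrM invfM.
rewrite mulrA.
by congr (_ * _); apply: eq_bigr => -[].
Qed.

Lemma reindex_avg (T : finType) (h : T -> T) (f : T -> R) :
  involutive h -> avg f = avg (f \o h).
Proof. by move=> hK; rewrite /avg (reindex_inj (inv_inj hK)). Qed.

Lemma avg_le_max (T : finType) (x0 : T) (f : T -> R) : exists x, avg f <= f x.
Proof.
case: (arg_maxP f (erefl (predT x0))) => x _ xmax; exists x.
by rewrite -[leRHS](avg_cst x0); apply: le_avg => y; apply: xmax.
Qed.

Lemma avg_eq1 (T : finType) (x0 : T) : avg (fun x => (x == x0)%:R) = #|T|%:R^-1.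
Proof.
rewrite /avg (bigD1 x0) //= eqxx big1 ?addr0 ?mulr1 // => y /negPf ->.
by [].
Qed.

Lemma avg_prod_ffun (T : finType) (N : nat) (f : T -> R) :
  avg (fun M : {ffun 'I_N -> T} => \prod_i f (M i)) = avg f ^+ N.
Proof.
rewrite /avg card_ffun card_ord exprMn natrX exprVn; congr (_ * _).
rewrite -(bigA_distr_bigA (fun _ x => f x)).
by rewrite prodr_const card_ord.
Qed.

End Average.

(** * Growth of the probability of a message *)

Section Splice.
Context {p : nat} {T : finType}.
Implicit Types (x u v w : {ffun 'I_p -> T}) (i : 'I_p).

(** With [u] fixed and [v] uniform, this is a uniform vector conditioned on its first [k]
    coordinates. Conditional probabilities of messages become averages over [v]. *)
Definition splice (k : nat) u v : {ffun 'I_p -> T} :=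
  [ffun a : 'I_p => if (a < k)%N then u a else v a].

Definition insert (i : 'I_p) u (l : T) v : {ffun 'I_p -> T} :=
  [ffun a : 'I_p => if (a < i)%N then u a else if a == i then l else v a].

Lemma splice_full u v : splice p u v = u.
Proof. by apply/ffunP => a; rewrite ffunE ltn_ord. Qed.

Lemma insert_at i u l v : insert i u l v i = l.
Proof. by rewrite ffunE ltnn eqxx. Qed.

Lemma splice_insert i u l v w : splice i (insert i u l v) w = splice i u w.
Proof. by apply/ffunP => a; rewrite !ffunE; case: ltnP. Qed.

Lemma spliceS_insert i u l v w :
  splice i.+1 (insert i u l v) w = insert i u l w.
Proof.
apply/ffunP => a; rewrite !ffunE ltnS leq_eqVlt -val_eqE.
by case: eqP => /= [->|_]; rewrite ?ltnn // ; case: ltnP.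
Qed.

Lemma insert_splice i u l v : insert i u l v = splice i u (insert i v l v).
Proof. by apply/ffunP => a; rewrite !ffunE; case: ltnP. Qed.

Context {R : realType}.

(** Swapping the tails of [u] and [v] is an involution on pairs of vectors. *)
Lemma avg_splice2 k (f : {ffun 'I_p -> T} -> {ffun 'I_p -> T} -> R) :
  avg (fun u => avg (fun v => f (splice k u v) (splice k v u))) =
  avg (fun u => avg (f u)).
Proof.
rewrite -(avg_pair (fun x : _ * _ => f (splice k x.1 x.2) (splice k x.2 x.1))).
rewrite -(avg_pair (fun x : _ * _ => f x.1 x.2)).
rewrite [RHS](@reindex_avg _ _
  (fun x : _ * _ => (splice k x.1 x.2, splice k x.2 x.1))) //.
by move=> [u v] /=; congr pair; apply/ffunP => a; rewrite !ffunE; case: ltnP.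
Qed.

Lemma avg_insert_id i (f : {ffun 'I_p -> T} -> R) :
  avg (fun l => avg (fun v => f (insert i v l v))) = avg f.
Proof.
(* For empty [T] both sides are [0]: [i] shows that [p] is positive, so there are no vectors either.
   Otherwise, exchanging [l] with [v i] is an involution on pairs. *)
have [T0|/card_gt0P [l0 _]] := posnP #|T|.
  rewrite /avg T0 invr0 mul0r card_ffun T0 card_ord exp0n ?invr0 ?mul0r //.
  exact: leq_ltn_trans (leq0n i) (ltn_ord i).
rewrite -(avg_pair (fun x : _ * _ => f (insert i x.2 x.1 x.2))).
rewrite (@reindex_avg _ _ (fun x : T * {ffun 'I_p -> T} =>
  (x.2 i, insert i x.2 x.1 x.2))) /=; last first.
  move=> [l v] /=; congr pair; rewrite ?insert_at //.
  apply/ffunP => a; rewrite !ffunE; case: ltnP => // ?.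
  by case: eqP => [->|].
rewrite avg_pair /= exchange_avg.
apply: eq_avg => v; rewrite -[RHS](avg_cst l0); apply: eq_avg => l; congr f.
apply/ffunP => a; rewrite !ffunE; case: ltnP => // ?.
by case: eqP => [->|].
Qed.

Lemma avg_insert i u (f : {ffun 'I_p -> T} -> R) :
  avg (fun l => avg (fun v => f (insert i u l v))) =
  avg (fun v => f (splice i u v)).
Proof.
rewrite -[RHS](avg_insert_id i); apply: eq_avg => l; apply: eq_avg => v.
by rewrite -insert_splice.
Qed.

Lemma avg_insert3 i (f : {ffun 'I_p -> T} -> R) :
  avg (fun u => avg (fun l => avg (fun v => f (insert i u l v)))) = avg f.
Proof.
under eq_avg do rewrite avg_insert.
have [T0|/card_gt0P [l0 _]] := posnP #|T|.
  rewrite /avg card_ffun T0 card_ord exp0n ?invr0 ?mul0r //.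
  exact: leq_ltn_trans (leq0n i) (ltn_ord i).
rewrite (avg_splice2 i (fun u _ => f u)); apply: eq_avg => u.
exact: (avg_cst [ffun=> l0]).
Qed.

End Splice.

Section Chain.
Context {R : realType}.

Definition prob (T : finType) (P : pred T) : R := avg (fun x => (P x)%:R).

Lemma prob_ge0 (T : finType) (P : pred T) : 0 <= prob P.
Proof. by apply: avg_ge0 => x; rewrite ler0n. Qed.

Lemma ln_le_sub1 (u : R) : 0 < u -> ln u <= u - 1.
Proof.
move=> u0; have -> : ln u = ln (1 + (u - 1)) by congr ln; ring.
by apply: le_ln1Dx; lra.
Qed.

(** From [ln (u / t) <= u / t - 1], the two sides differ by at least [(1 - u / t) * (1 - t)]. *)
Lemma ln_loss_anti (u t : R) : 0 < u -> u <= t -> t <= 1 ->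
  t - 1 - ln t <= u - 1 - ln u.
Proof.
move=> u0 ut t1; have t0 : 0 < t by apply: lt_le_trans ut.
have := ln_le_sub1 (divr_gt0 u0 t0).
rewrite ln_div // => H.
have e1 : u / t <= 1 by rewrite ler_pdivrMr ?mul1r.
have e2 : (u / t) * (1 - t) <= 1 * (1 - t) by apply: ler_wpM2r => //; lra.
have e3 : u / t * t = u by rewrite mulfVK // gt_eqF.
lra.
Qed.

Lemma avg_telescope (T : finType) n (g : nat -> T -> R) :
  \sum_(i < n) avg (fun x => g i.+1 x - g i x) = avg (g n) - avg (g 0%N).
Proof.
rewrite -avg_sum -avgB; apply: eq_avg => x.
elim: n => [|n IHn]; first by rewrite big_ord0 subrr.
by rewrite big_ord_recr /= IHn; ring.
Qed.

Context {p : nat} {T Msg : finType} (x0 : {ffun 'I_p -> T}).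
Variable L : {ffun 'I_p -> T} -> Msg.

(** The conditional probability of the message [l] given the first [k] coordinates of [x]. *)
Let G k x l : R := prob (fun w => L (splice k x w) == l).

Let G_gt0 k x : 0 < G k x (L x).
Proof.
rewrite /G /prob /avg (bigD1 x) //= mulr_gt0 //.
  by rewrite invr_gt0 ltr0n; apply/card_gt0P; exists x0.
have -> : splice k x x = x by apply/ffunP => a; rewrite ffunE if_same.
by rewrite eqxx ltr_wpDr // sumr_ge0.
Qed.

Let G_sum k x : \sum_l G k x l = 1.
Proof.
rewrite -avg_sum -[RHS](avg_cst x0); apply: eq_avg => w.
by rewrite (bigD1 (L (splice k x w))) //= eqxx big1 ?addr0 // => l /negPf;
   rewrite eq_sym => ->.
Qed.

Let G_splice k j x w l : (k <= j)%N -> G k (splice j x w) l = G k x l.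
Proof.
move=> kj; apply: eq_avg => v; congr ((L _ == l)%:R).
by apply/ffunP => a; rewrite !ffunE; case: ltnP => // ak; rewrite (leq_trans ak).
Qed.

(** Tower property: [h] sees only the first [k] coordinates, so the others may be resampled, and
    given the first [k] the message is [l] with probability [G k x l]. *)
Let avg_resample k (h : {ffun 'I_p -> T} -> Msg -> R) :
  (forall x w l, h (splice k x w) l = h x l) ->
  avg (fun x => h x (L x)) = \sum_l avg (fun x => h x l * G k x l).
Proof.
move=> hE; rewrite -avg_sum.
transitivity (avg (fun x => \sum_l (L x == l)%:R * h x l)).
  apply: eq_avg => x; rewrite (bigD1 (L x)) //= eqxx mul1r big1 ?addr0 //.
  by move=> l /negPf; rewrite eq_sym => ->; rewrite mul0r.
rewrite !avg_sum; apply: eq_bigr => l _.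
transitivity (avg (fun x => avg (fun w => (L (splice k x w) == l)%:R * h x l))).
  transitivity (avg (fun x => avg (fun w : {ffun 'I_p -> T} =>
    (L x == l)%:R * h x l))).
    by apply: eq_avg => x; rewrite (avg_cst x0).
  rewrite -(avg_splice2 k (fun x _ => (L x == l)%:R * h x l)).
  by apply: eq_avg => x; apply: eq_avg => w; rewrite hE.
by apply: eq_avg => x; rewrite avgZr mulrC.
Qed.

(** Weighting the ratio by [G i.+1 x l] leaves the sum of [G i x l] over the possible messages. *)
Let avg_ratio (i : nat) : avg (fun x => G i x (L x) / G i.+1 x (L x)) <= 1.
Proof.
rewrite (@avg_resample i.+1 (fun x l => G i x l / G i.+1 x l)); last first.
  by move=> x w l; rewrite !G_splice.
rewrite -avg_sum -[leRHS](avg_cst x0); apply: le_avg => x.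
rewrite -(G_sum i x); apply: ler_sum => l _.
have [->|nz] := eqVneq (G i.+1 x l) 0; first by rewrite mulr0 prob_ge0.
by rewrite mulfVK.
Qed.

(** The entropy of a message is at most the logarithm of the number of messages. The bound
    [ln u <= u - 1] at [u = 1 / (#|Msg| * G)] replaces Jensen's inequality. *)
Let avg_entropy : avg (fun x => - ln (G 0 x (L x))) <= ln #|Msg|%:R.
Proof.
have m0 : 0 < #|Msg|%:R :> R by rewrite ltr0n; apply/card_gt0P; exists (L x0).
have H x : - ln (G 0 x (L x)) <= ln #|Msg|%:R + (#|Msg|%:R^-1 * (1 / G 0 x (L x)) - 1).
  have g0 := G_gt0 0 x.
  have mg0 := mulr_gt0 m0 g0.
  rewrite mul1r -invfM; have := @ln_le_sub1 (#|Msg|%:R * G 0 x (L x))^-1.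
  by rewrite invr_gt0 lnV ?posrE // lnM ?posrE // => /(_ mg0); lra.
apply: le_trans (le_avg H) _.
rewrite avgD (avg_cst x0) avgB (avg_cst x0) avgZl gerDl subr_le0.
rewrite ler_pdivrMl // mulr1.
rewrite (@avg_resample 0 (fun x l => 1 / G 0 x l)); last first.
  by move=> x w l; rewrite G_splice.
have -> : #|Msg|%:R = \sum_(l : Msg) 1 :> R by rewrite sumr_const.
apply: ler_sum => l _.
rewrite -[leRHS](avg_cst x0); apply: le_avg => x.
have [->|nz] := eqVneq (G 0 x l) 0; first by rewrite mulr0 ler01.
by rewrite mulfVK.
Qed.

(* Revealing the coordinates of a random [x] one by one, the probability of the
   message [L x] grows to [1], typically from no less than about [1 / #|Msg|];
   hence on a random coordinate it rarely grows by a factor above [1 / tau]. *)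
Lemma message_growth (tau : R) : 0 < tau -> tau < 1 ->
  avg (fun i : 'I_p => avg (fun u => avg (fun l => prob (fun v =>
    prob (fun w => L (splice i u w) == L (insert i u l v)) <
    tau * prob (fun w => L (insert i u l w) == L (insert i u l v)))))) <=
  ln #|Msg|%:R / p%:R / (tau - 1 - ln tau).
Proof.
move=> tau0 tau1.
have f0 : 0 < tau - 1 - ln tau.
  (* Only the weak bound [ln u <= u - 1] is at hand; applying it to both factors of [tau], split at
     the midpoint of [tau] and [1], makes the inequality strict. *)
  have h : tau < (1 + tau) / 2 by lra.
  have h0 : 0 < (1 + tau) / 2 by lra.
  have := @ln_le_sub1 (tau / ((1 + tau) / 2)).
  rewrite divr_gt0 // ln_div // => /(_ isT) H1.
  have := ln_le_sub1 h0 => H2.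
  have H3 : tau / ((1 + tau) / 2) < 1 + (tau - 1) - (((1 + tau) / 2) - 1).
    by rewrite ltr_pdivrMr //; nra.
  lra.
rewrite ler_pdivlMr // [leRHS]mulrC {1}/avg card_ord -mulrA.
have [p0|p0] := posnP p.
  have -> : p%:R^-1 = 0 :> R by rewrite p0 invr0.
  by rewrite !mul0r.
rewrite ler_pM2l ?invr_gt0 ?ltr0n //.
(* A bad event is charged to the loss [g - 1 - ln g] of the ratio [g] of successive conditional
   probabilities: the loss is nonnegative, and it is at least its value at [tau] once [g < tau]. *)
apply: le_trans (_ : \sum_(i < p) avg (fun x => G i x (L x) / G i.+1 x (L x) - 1 -
   ln (G i x (L x) / G i.+1 x (L x))) <= _).
  rewrite mulr_suml; apply: ler_sum => i _.
  rewrite -(avg_insert3 i (fun x => G i x (L x) / G i.+1 x (L x) - 1 - _)).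
  rewrite -avgZr; apply: le_avg => u; rewrite -avgZr; apply: le_avg => l.
  rewrite -avgZr; apply: le_avg => v.
  set x := insert i u l v.
  have gi := G_gt0 i x; have gi1 := G_gt0 i.+1 x.
  case: ltP => [bad|_]; last first.
    by rewrite mul0r; have := ln_le_sub1 (divr_gt0 gi gi1); lra.
  rewrite mul1r; apply: ln_loss_anti; rewrite ?divr_gt0 ?(ltW tau1) //.
  rewrite ler_pdivrMr //; apply: ltW.
  have -> : G i x (L x) = prob (fun w => L (splice i u w) == L x).
    by apply: eq_avg => w; rewrite splice_insert.
  have -> // : G i.+1 x (L x) = prob (fun w => L (insert i u l w) == L x).
  by apply: eq_avg => w; rewrite spliceS_insert.
(* By [avg_ratio] the part [g - 1] averages to at most [0]; the logarithms that remain telescope. *)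
apply: le_trans (_ : \sum_(i < p) avg (fun x =>
    ln (G i.+1 x (L x)) - ln (G i x (L x))) <= _).
  apply: ler_sum => i _; rewrite !avgB (avg_cst x0).
  have := avg_ratio i.
  rewrite (_ : avg (fun x => ln (G i x (L x) / G i.+1 x (L x))) =
    avg (fun x => ln (G i x (L x))) - avg (fun x => ln (G i.+1 x (L x)))).
    lra.
  by rewrite -avgB; apply: eq_avg => x; rewrite ln_div ?posrE.
rewrite (avg_telescope p (fun k x => ln (G k x (L x)))).
have -> : avg (fun x => ln (G p x (L x))) = 0.
  rewrite -[RHS](avg_cst x0); apply: eq_avg => x; apply/eqP.
  rewrite ln_eq0 // /G -[eqbRHS](avg_cst x0); apply/eqP/eq_avg => w.
  by rewrite splice_full eqxx.
rewrite sub0r; apply: le_trans avg_entropy.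
by rewrite -[leLHS]mulN1r -avgZl; apply: le_avg => x; rewrite mulN1r.
Qed.

End Chain.

(** * Fixing messages and responses greedily *)

Section Greedy.
Context {R : realType}.

Lemma prob_cond_sum (V : finType) (Msg : finType) (L : V -> Msg) (P : pred V)
    (Q : pred Msg) : (forall v, P v -> Q (L v)) ->
  prob P <= \sum_(l | Q l) prob (fun v => L v == l) :> R.
Proof.
move=> PQ; rewrite -avg_sum; apply: le_avg => v.
case Pv: (P v); last by rewrite sumr_ge0.
by rewrite (bigD1 (L v)) ?PQ //= eqxx lerDl sumr_ge0.
Qed.

Lemma prob_cond_sum_eq (V : finType) (Msg : finType) (L : V -> Msg)
    (Q : pred Msg) :
  prob (fun v => Q (L v)) = \sum_(l | Q l) prob (fun v => L v == l) :> R.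
Proof.
rewrite -avg_sum; apply: eq_avg => v.
case Qv: (Q (L v)).
  rewrite (bigD1 (L v)) //= eqxx big1 ?addr0 // => l /andP[_ /negPf].
  by rewrite eq_sym => ->.
rewrite big1 // => l Ql; case: eqP => // e.
by rewrite e Ql in Qv.
Qed.

Lemma prob_le1 (T : finType) (x0 : T) (P : pred T) : prob P <= 1 :> R.
Proof.
rewrite -[leRHS](avg_cst x0); apply: le_avg => x; by rewrite lern1 leq_b1.
Qed.

Context {X V Msg W : finType} (x0 : X) (v0 : V) (w0 : W).
Variables (L : X -> V -> Msg) (L0 : W -> Msg) (val : X -> V -> R).
Hypothesis val01 : forall x v, 0 <= val x v <= 1.

(** For fixed [x], the [v] that are not bad and whose value is within [eta] of the average have
    probability at least [eta]. Their messages then have total probability at least [eta / K] under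
    [L0], so [N] independent samples all miss them with probability at most [(1 - eta / K) ^+ N].
    The samples do not depend on [x], so averaging over [x] fixes them. *)
Lemma exists_samples (K eta : R) (N : nat) : 1 <= K -> 0 <= eta -> eta <= 1 ->
  let bad x v := prob (fun w => L0 w == L x v) <
                 K^-1 * prob (fun v' => L x v' == L x v) in
  exists (M : {ffun 'I_N -> W}) (sel : X -> V),
    avg (fun x => avg (fun v => val x v - (bad x v)%:R)) - eta - (1 - eta / K) ^+ N <=
    avg (fun x => val x (sel x) * [exists r, L0 (M r) == L x (sel x)]%:R).
Proof.
move=> K1 eta0 eta1 bad.
have K0 : 0 < K by apply: lt_le_trans K1.
pose f (M : {ffun 'I_N -> W}) x v := val x v * [exists r : 'I_N, L0 (M r) == L x v]%:R.
pose best (M : {ffun 'I_N -> W}) x := [arg max_(v > v0) f M x v]%O.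
have bestP M x v : f M x v <= f M x (best M x).
  by rewrite /best; case: arg_maxP => // v' _; apply.
have f_ge0 M x v : 0 <= f M x v.
  by rewrite mulr_ge0 ?ler0n //; case/andP: (val01 x v).
suff H x : avg (fun v => val x v - (bad x v)%:R) - eta - (1 - eta / K) ^+ N <=
           avg (fun M => f M x (best M x)).
  have [M HM] := avg_le_max [ffun=> w0] (fun M => avg (fun x => f M x (best M x))).
  exists M, (best M); apply: le_trans HM.
  rewrite [leRHS]exchange_avg; apply: le_trans (le_avg H).
  by rewrite !avgB !(avg_cst x0).
set a := avg _.
have hit0 : 0 <= (1 - eta / K) ^+ N.
  by apply: exprn_ge0; rewrite subr_ge0 ler_pdivrMr // mul1r (le_trans eta1).
(* When [a <= eta] the bound is not positive. Otherwise [0 <= a - eta], which absorbs the bad [v] in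
   the estimate of [prob good]. *)
have [a_le|a_gt] := leP a eta.
  by apply: le_trans (_ : 0 <= _); [lra | apply: avg_ge0].
have a1 : a <= 1.
  rewrite -(avg_cst v0 1); apply: le_avg => v.
  have /andP[_] := val01 x v; have : 0 <= (bad x v)%:R :> R by rewrite ler0n.
  lra.
pose good v := ~~ bad x v && (a - eta <= val x v).
have good_ge : eta <= prob good.
  have : a <= avg (fun v => (good v)%:R + (a - eta)).
    apply: le_avg => v; rewrite /good; have /andP[_ v1] := val01 x v.
    by case: (bad x v) => /=; [lra | case: (leP (a - eta) (val x v)) => /= ?; lra].
  by rewrite avgD (avg_cst v0) -/(prob good); lra.
pose Q := [pred l | [exists v, good v && (L x v == l)]].
pose h : R := prob (fun w => Q (L0 w)).
have h_ge : eta / K <= h.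
  rewrite /h prob_cond_sum_eq ler_pdivrMr // mulrC mulr_sumr.
  apply: le_trans good_ge _.
  apply: le_trans (prob_cond_sum (L := L x) (Q := Q) _) _.
    by move=> v gv; apply/existsP; exists v; rewrite gv eqxx.
  apply: ler_sum => l /existsP[v /andP[/andP[nb _] /eqP <-]].
  by move: nb; rewrite /bad -leNgt ler_pdivrMl.
pose miss (M : {ffun 'I_N -> W}) : R := \prod_(r < N) (1 - (Q (L0 (M r)))%:R).
have miss_ge0 M : 0 <= miss M.
  by apply: prodr_ge0 => r _; rewrite subr_ge0 lern1 leq_b1.
have miss_le : avg miss <= (1 - eta / K) ^+ N.
  rewrite (avg_prod_ffun N (fun w => 1 - (Q (L0 w))%:R)) avgB (avg_cst w0).
  have h1 : h <= 1 by apply: prob_le1.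
  by apply: lerXn2r; rewrite ?nnegrE -/(prob _) -/h; lra.
apply: le_trans (_ : avg (fun M => (a - eta) - miss M) <= _).
  by rewrite avgB (avg_cst [ffun=> w0]); lra.
apply: le_avg => M.
have [/existsP[r /existsP[v /andP[gv /eqP Lv]]]|nohit] :=
    boolP [exists r, Q (L0 (M r))].
  apply: le_trans (bestP M x v); rewrite /f.
  have -> : [exists r : 'I_N, L0 (M r) == L x v].
    by apply/existsP; exists r; rewrite Lv.
  by case/andP: gv => _; have := miss_ge0 M; rewrite mulr1; lra.
have -> : miss M = 1.
  rewrite /miss big1 // => r _; move: nohit; rewrite negb_exists.
  by move=> /forallP/(_ r)/negPf ->; rewrite subr0.
by apply: le_trans (f_ge0 M x (best M x)); lra.
Qed.

End Greedy.

Section Fixing.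
Context {R : realType} {X V Msg W : finType} (x0 : X) (v0 : V) (w0 : W).
Variables (L : X -> V -> Msg) (L0 : W -> Msg) (val : X -> V -> R).
Hypothesis val01 : forall x v, 0 <= val x v <= 1.

(** The response is drawn from the law of [L0], hence independently of [x], and [sel x] is the best
    [v] that produces it. A response that is not bad is at most a factor [1 - eta] less likely than
    under [L x], and this factor costs at most [eta] because values are at most [1]. *)
Lemma exists_response (eta : R) : 0 <= eta -> eta <= 1 ->
  let bad x v := prob (fun w => L0 w == L x v) <
                 (1 - eta) * prob (fun v' => L x v' == L x v) in
  exists (r : Msg) (sel : X -> V),
    avg (fun x => avg (fun v => val x v - (bad x v)%:R)) - eta <=
    avg (fun x => val x (sel x) * (L x (sel x) == r)%:R).
Proof.
move=> eta0 eta1 bad.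
pose f r x v := val x v * (L x v == r)%:R.
pose best r x := [arg max_(v > v0) f r x v]%O.
have bestP r x v : f r x v <= f r x (best r x).
  by rewrite /best; case: arg_maxP => // v' _; apply.
have f_ge0 r x v : 0 <= f r x v.
  by rewrite mulr_ge0 ?ler0n //; case/andP: (val01 x v).
have [w Hw] := avg_le_max w0 (fun w => avg (fun x => f (L0 w) x (best (L0 w) x))).
exists (L0 w), (best (L0 w)); apply: le_trans Hw.
rewrite [leRHS]exchange_avg -[X in _ - X <= _](avg_cst x0) -avgB; apply: le_avg => x.
apply: le_trans (_ : (1 - eta) * avg (fun v => val x v - (bad x v)%:R) <= _).
  have : avg (fun v => val x v - (bad x v)%:R) <= 1.
    rewrite -[leRHS](avg_cst v0); apply: le_avg => v; rewrite /=.
    have /andP[_] := val01 x v.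
    have : 0 <= (bad x v)%:R :> R by rewrite ler0n.
    lra.
  set y := avg _ => y1; have := ler_wpM2l eta0 y1; lra.
pose P0 r : R := prob (fun w => L0 w == r).
pose Px r : R := prob (fun v => L x v == r).
apply: le_trans (_ : \sum_r P0 r * f r x (best r x) <= _); last first.
  rewrite /P0 /prob; under eq_bigr do rewrite -avgZr.
  rewrite -avg_sum; apply: le_avg => u.
  rewrite (bigD1 (L0 u)) //= eqxx mul1r big1 ?addr0 // => r /negPf.
  by rewrite eq_sym => ->; rewrite mul0r.
have step r : avg (fun v => f r x v) <= Px r * f r x (best r x).
  rewrite -avgZr; apply: le_avg => v; case: eqP => [_|ne].
    by rewrite mul1r bestP.
  by rewrite /f; case: eqP => // _; rewrite mulr0 mul0r.
apply: le_trans (_ : \sum_r (1 - eta) * (~~ (P0 r < (1 - eta) * Px r))%:R *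
    avg (fun v => f r x v) <= _).
  under eq_bigr do rewrite -mulrA -avgZl.
  rewrite -mulr_sumr -avg_sum ler_wpM2l ?subr_ge0 //; apply: le_avg => v.
  rewrite (bigD1 (L x v)) //= big1 ?addr0; last first.
    by move=> r /negPf; rewrite eq_sym /f => ->; rewrite !mulr0.
  rewrite /f eqxx mulr1 /bad -/(P0 _) -/(Px _).
  by have /andP[vge _] := val01 x v; have /andP[_] := val01 x v; case: ltP => /=; lra.
apply: ler_sum => r _.
have P0_ge0 : 0 <= P0 r by apply: prob_ge0.
have fb := f_ge0 r x (best r x).
case: ltP => [_|Pr] /=; first by rewrite mulr0 mul0r mulr_ge0.
rewrite mulr1; apply: le_trans (ler_wpM2l _ (step r)) _; first by rewrite subr_ge0.
by rewrite mulrA ler_wpM2r.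
Qed.

End Fixing.

(** * The recursive game and round elimination *)

Section Game.
Context {R : realType}.
Variable q : nat.

(* A round [r] stands for [r.1] probes and [r.2.+1] blocks. *)
Fixpoint query (rs : seq (nat * nat)) : finType :=
  if rs is r :: rs' then {ffun 'I_r.2.+1 -> 'I_q.+1 * query rs'} else unit.

(* In [(i, u, F)] the blocks of [u] from position [i] on are junk: in [expect]
   they are independent of the query. *)
Fixpoint dbase (rs : seq (nat * nat)) : finType :=
  if rs is r :: rs' then
    ('I_r.2.+1 * {ffun 'I_r.2.+1 -> 'I_q.+1 * query rs'} *
     {ffun 'I_q.+1 -> dbase rs'})%type
  else bool.

Fixpoint query0 rs : query rs :=
  if rs is r :: rs' then [ffun=> (ord0, query0 rs')] else tt.

Fixpoint dbase0 rs : dbase rs :=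
  if rs is r :: rs' then (ord0, query0 (r :: rs'), [ffun=> dbase0 rs'])
  else true.

Fixpoint target rs : dbase rs -> query rs -> bool :=
  if rs is r :: rs' then fun D x =>
    target (D.2 (x D.1.1).1) (x D.1.1).2
  else fun b _ => b.

(** The law of the hard instances. Query and database share the blocks before [i]; the smaller
    instance [(D, x)] supplies the query in block [i] and the database below child [c]. Using
    [insert] for both puts them in the form required by [message_growth]. *)
Fixpoint expect rs : (dbase rs -> query rs -> R) -> R :=
  if rs is r :: rs' then fun f =>
    avg (fun i => avg (fun u => avg (fun v => avg (fun c => avg (fun G => avg (fun H =>
      expect (fun D x => f (i, u, insert c G D H) (insert i u (c, x) v))))))))
  else fun f => avg (fun b => f b tt).

Lemma eq_expect rs (f g : dbase rs -> query rs -> R) :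
  f =2 g -> expect f = expect g.
Proof.
elim: rs f g => [|r rs IH] f g fg /=; first by apply: eq_avg => b.
do 6![apply: eq_avg => ?]; apply: IH => D x; exact: fg.
Qed.

Lemma le_expect rs (f g : dbase rs -> query rs -> R) :
  (forall D x, f D x <= g D x) -> expect f <= expect g.
Proof.
elim: rs f g => [|r rs IH] f g fg /=; first by apply: le_avg => b.
do 6![apply: le_avg => ?]; apply: IH => D x; exact: fg.
Qed.

Lemma expect_sum rs (I : finType) (f : I -> dbase rs -> query rs -> R) :
  expect (fun D x => \sum_i f i D x) = \sum_i expect (f i).
Proof.
elim: rs f => [|r rs IH] f /=; first by rewrite -avg_sum.
do 6![rewrite -avg_sum; apply: eq_avg => ?]; exact: IH.
Qed.

Lemma expectZl rs a (f : dbase rs -> query rs -> R) :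
  expect (fun D x => a * f D x) = a * expect f.
Proof.
elim: rs f => [|r rs IH] f /=; first by rewrite -avgZl.
do 6![rewrite -avgZl; apply: eq_avg => ?]; exact: IH.
Qed.

Lemma expect_avg rs (I : finType) (f : I -> dbase rs -> query rs -> R) :
  expect (fun D x => avg (fun i => f i D x)) = avg (fun i => expect (f i)).
Proof. by rewrite expectZl expect_sum. Qed.

(** Query and database are correlated, but each marginal is uniform: [insert] glues independent
    uniform pieces. *)
Lemma expect_query rs (f : query rs -> R) : expect (fun _ x => f x) = avg f.
Proof.
elim: rs f => [|r rs IH] f /=.
  by rewrite (avg_cst true) -[LHS](avg_cst tt); apply: eq_avg => -[].
rewrite -[RHS](avg_cst (ord0 : 'I_r.2.+1)); apply: eq_avg => i.
rewrite -[RHS](avg_insert3 i); apply: eq_avg => u.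
rewrite [LHS]exchange_avg [RHS]avg_pair.
apply: eq_avg => c; rewrite [RHS]exchange_avg; apply: eq_avg => v.
have F0 := [ffun=> dbase0 rs] : {ffun 'I_q.+1 -> dbase rs}.
by rewrite !(avg_cst F0) IH.
Qed.

Lemma expect_dbase rs (f : dbase rs -> R) : expect (fun D _ => f D) = avg f.
Proof.
elim: rs f => [|r rs IH] f //=.
rewrite avg_pair; rewrite avg_pair; apply: eq_avg => i; apply: eq_avg => u.
rewrite (avg_cst (query0 (r :: rs))).
rewrite -[RHS](avg_cst (ord0 : 'I_q.+1)); apply: eq_avg => c.
rewrite -[RHS](avg_insert3 c); apply: eq_avg => G.
rewrite [RHS]exchange_avg; apply: eq_avg => H; exact: IH.
Qed.

(** The conditional expectation given the query; the query is uniform, so dividing by its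
    probability is multiplying by [#|query rs|]. *)
Definition expect_at_query rs (x : query rs) (f : dbase rs -> R) : R :=
  #|query rs|%:R * expect (fun D x' => (x' == x)%:R * f D).

Definition expect_at_dbase rs (D : dbase rs) (f : query rs -> R) : R :=
  #|dbase rs|%:R * expect (fun D' x => (D' == D)%:R * f x).

Lemma expect_by_query rs (f : dbase rs -> query rs -> R) :
  expect f = avg (fun x => expect_at_query x (f^~ x)).
Proof.
rewrite avgZl /avg mulrA mulfV ?mul1r; last first.
  by rewrite pnatr_eq0 -lt0n; apply/card_gt0P; exists (query0 rs).
rewrite -expect_sum; apply: eq_expect => D x.
rewrite (bigD1 x) //= eqxx mul1r big1 ?addr0 // => y /negPf.
by rewrite eq_sym => ->; rewrite mul0r.
Qed.

Lemma expect_by_dbase rs (f : dbase rs -> query rs -> R) :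
  expect f = avg (fun D => expect_at_dbase D (f D)).
Proof.
rewrite avgZl /avg mulrA mulfV ?mul1r; last first.
  by rewrite pnatr_eq0 -lt0n; apply/card_gt0P; exists (dbase0 rs).
rewrite -expect_sum; apply: eq_expect => D x.
rewrite (bigD1 D) //= eqxx mul1r big1 ?addr0 // => y /negPf.
by rewrite eq_sym => ->; rewrite mul0r.
Qed.

Lemma expect_at_query01 rs (x : query rs) (f : dbase rs -> R) :
  (forall D, 0 <= f D <= 1) -> 0 <= expect_at_query x f <= 1.
Proof.
move=> f01; apply/andP; split.
  rewrite mulr_ge0 ?ler0n //.
  rewrite -[leLHS](mul0r (expect (fun (_ : dbase rs) (_ : query rs) => 0))).
  rewrite -expectZl; apply: le_expect => D y.
  by rewrite mul0r mulr_ge0 ?ler0n //; case/andP: (f01 D).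
apply: le_trans (_ : #|query rs|%:R * expect (fun (_ : dbase rs) y => (y == x)%:R) <= _).
  rewrite ler_wpM2l ?ler0n //; apply: le_expect => D y.
  by rewrite ler_piMr ?ler0n //; case/andP: (f01 D).
rewrite (expect_query (fun y => (y == x)%:R)) avg_eq1 mulfV //.
by rewrite pnatr_eq0 -lt0n; apply/card_gt0P; exists x.
Qed.

Lemma expect_at_dbase01 rs (D : dbase rs) (f : query rs -> R) :
  (forall x, 0 <= f x <= 1) -> 0 <= expect_at_dbase D f <= 1.
Proof.
move=> f01; apply/andP; split.
  rewrite mulr_ge0 ?ler0n //.
  rewrite -[leLHS](mul0r (expect (fun (_ : dbase rs) (_ : query rs) => 0))).
  rewrite -expectZl; apply: le_expect => E y.
  by rewrite mul0r mulr_ge0 ?ler0n //; case/andP: (f01 y).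
apply: le_trans (_ : #|dbase rs|%:R * expect (fun E (_ : query rs) => (E == D)%:R) <= _).
  rewrite ler_wpM2l ?ler0n //; apply: le_expect => E y.
  by rewrite ler_piMr ?ler0n //; case/andP: (f01 y).
rewrite (expect_dbase (fun E => (E == D)%:R)) avg_eq1 mulfV //.
by rewrite pnatr_eq0 -lt0n; apply/card_gt0P; exists D.
Qed.

Lemma le_expect_at_dbase rs (D : dbase rs) (f g : query rs -> R) :
  (forall x, f x <= g x) -> expect_at_dbase D f <= expect_at_dbase D g.
Proof.
move=> fg; rewrite ler_wpM2l ?ler0n //; apply: le_expect => E x.
by rewrite ler_wpM2l ?ler0n.
Qed.

Lemma expect_at_queryZr rs (x : query rs) (f : dbase rs -> R) a :
  expect_at_query x (fun D => f D * a) = expect_at_query x f * a.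
Proof.
rewrite /expect_at_query -[RHS]mulrA; congr (_ * _); rewrite mulrC -expectZl.
by apply: eq_expect => D y; ring.
Qed.

Lemma expect_at_dbaseZr rs (D : dbase rs) (f : query rs -> R) a :
  expect_at_dbase D (fun x => f x * a) = expect_at_dbase D f * a.
Proof.
rewrite /expect_at_dbase -[RHS]mulrA; congr (_ * _); rewrite mulrC -expectZl.
by apply: eq_expect => E y; ring.
Qed.

(** * Cell-probe strategies and the elimination of one round *)

Section Strategy.
Variables (s : nat) (W : finType).

Fixpoint strategy (rs : seq (nat * nat)) : Type :=
  if rs is r :: rs' then
    (r.1.-tuple 'I_s * (r.1.-tuple W -> strategy rs'))%type
  else bool.

Fixpoint run rs (T : 'I_s -> W) : strategy rs -> bool :=
  if rs is r :: rs' then fun a =>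
    run T (a.2 [tuple T (tnth a.1 j) | j < r.1])
  else fun b => b.

Definition success rs (T : dbase rs -> 'I_s -> W) (A : query rs -> strategy rs) : R :=
  expect (fun D x => (run (T D) (A x) == target D x)%:R).

(** The bound of [message_growth] for [m] messages about [p] coordinates. *)
Definition growth_bound (m : nat) (p : nat) (tau : R) : R :=
  ln m%:R / p%:R / (tau - 1 - ln tau).

Lemma success_nil T (A : query [::] -> strategy [::]) : success T A = 2^-1.
Proof.
rewrite /success /= /avg card_bool big_bool /= -[RHS]mulr1; congr (_ * _).
by case: (A tt); rewrite /= ?addr0 ?add0r.
Qed.

(** The losses in order: address lists that are atypical for block [i]; the two losses of
    [exists_samples]; cell contents that are atypical for child [c]; the loss of
    [exists_response]. *)
Lemma elimination_step (r : nat * nat) (rs : seq (nat * nat))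
    (T : dbase (r :: rs) -> 'I_s -> W) (A : query (r :: rs) -> strategy (r :: rs))
    (K eta : R) (N : nat) : 1 < K -> 0 < eta -> eta < 1 ->
  exists (T' : dbase rs -> 'I_s -> W) (A' : query rs -> strategy rs),
    success T A <= success T' A' +
      (growth_bound (s ^ r.1) r.2.+1 K^-1 + eta + (1 - eta / K) ^+ N +
       growth_bound (#|W| ^ (N * r.1)) q.+1 (1 - eta) + eta).
Proof.
move=> K1 eta0 eta1; have K0 : 0 < K by apply: lt_trans K1.
have [eta0' eta1'] := (ltW eta0, ltW eta1).
pose S (i : 'I_r.2.+1) (u : {ffun 'I_r.2.+1 -> 'I_q.+1 * query rs}) (c : 'I_q.+1)
    (G H : {ffun 'I_q.+1 -> dbase rs}) (D : dbase rs) (y : query rs)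
    (v : {ffun 'I_r.2.+1 -> 'I_q.+1 * query rs}) : R :=
  (run (T (i, u, insert c G D H)) (A (insert i u (c, y) v)) == target D y)%:R.
pose F0 : {ffun 'I_q.+1 -> dbase rs} := [ffun=> dbase0 rs].
have S01 i u c G H D y v : 0 <= S i u c G H D y v <= 1.
  by rewrite /S ler0n lern1 leq_b1.
have SE : success T A = avg (fun i => avg (fun u => avg (fun v => avg (fun c =>
    avg (fun G => avg (fun H => expect (fun D y => S i u c G H D y v))))))).
  rewrite /success /=; do 6![apply: eq_avg => ?]; apply: eq_expect => D y.
  by rewrite /S /target -/target /= !insert_at /=.
(* The success probability conditioned on the query path up to and including block [i], as a
   function of the later blocks [v], which the strategy will be free to choose. *)
pose VA (i : 'I_r.2.+1) u (l : 'I_q.+1 * query rs) v := expect_at_query l.2 (fun D =>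
  avg (fun G => avg (fun H => S i u l.1 G H D l.2 v))).
have VA01 i u l v : 0 <= VA i u l v <= 1.
  apply: expect_at_query01 => D; apply/andP; split.
    apply: avg_ge0 => G; apply: avg_ge0 => H.
    by case/andP: (S01 i u l.1 G H D l.2 v).
  rewrite -[leRHS](avg_cst F0); apply: le_avg => G.
  rewrite -[leRHS](avg_cst F0); apply: le_avg => H.
  by case/andP: (S01 i u l.1 G H D l.2 v).
have SVA : success T A =
    avg (fun i => avg (fun u => avg (fun l => avg (VA i u l)))).
  rewrite SE; apply: eq_avg => i; apply: eq_avg => u.
  rewrite [LHS]exchange_avg [RHS]avg_pair; apply: eq_avg => c.
  rewrite [RHS]exchange_avg; apply: eq_avg => v.
  transitivity (expect (fun D y => avg (fun G => avg (fun H => S i u c G H D y v)))).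
    by rewrite expect_avg; apply: eq_avg => G; rewrite expect_avg.
  exact: expect_by_query.
pose LA (i : 'I_r.2.+1) (u : {ffun 'I_r.2.+1 -> 'I_q.+1 * query rs}) l v :=
  (A (insert i u l v)).1.
pose LA0 (i : 'I_r.2.+1) (u w : {ffun 'I_r.2.+1 -> 'I_q.+1 * query rs}) :=
  (A (splice i u w)).1.
pose badA (i : 'I_r.2.+1) u l v := prob (fun w => LA0 i u w == LA i u l v) <
  K^-1 * prob (fun w => LA i u l w == LA i u l v) :> R.
pose u0 : {ffun 'I_r.2.+1 -> 'I_q.+1 * query rs} := [ffun=> (ord0, query0 rs)].
have := @message_growth R _ _ _ u0 (fun x => (A x).1) K^-1.
rewrite invr_gt0 invf_lt1 // card_tuple card_ord => /(_ K0 K1).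
rewrite -/(growth_bound _ _ _); set betaA := growth_bound _ _ _ => growthA.
have [i Hi] := avg_le_max (ord0 : 'I_r.2.+1) (fun i => avg (fun u => avg (fun l =>
  avg (fun v => VA i u l v - (badA i u l v)%:R)))).
have [u Hu] := avg_le_max u0 (fun u => avg (fun l =>
  avg (fun v => VA i u l v - (badA i u l v)%:R))).
have {Hi Hu} HA : success T A - betaA <=
    avg (fun l => avg (fun v => VA i u l v - (badA i u l v)%:R)).
  apply: le_trans (le_trans Hi Hu); rewrite SVA.
  apply: le_trans (lerB (lexx _) growthA) _; rewrite /prob.
  rewrite -avgB; apply: le_avg => i'; rewrite -avgB; apply: le_avg => u'.
  by rewrite -avgB; apply: le_avg => l; rewrite -avgB.
have [M [sel Hsel]] := @exists_samples R _ _ _ _ (ord0, query0 rs)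
  u0 u0 (LA i u) (LA0 i u) (VA i u) (VA01 i u)
  K eta N (ltW K1) eta0' eta1'.
pose hit l := [exists k, LA0 i u (M k) == LA i u l (sel l)].
pose S2 (c : 'I_q.+1) G H D y := S i u c G H D y (sel (c, y)) * (hit (c, y))%:R.
have S2_01 c G H D y : 0 <= S2 c G H D y <= 1.
  rewrite /S2; case/andP: (S01 i u c G H D y (sel (c, y))) => s0 s1.
  by case: (hit _); rewrite ?mulr1 ?mulr0 ?s0 ?lexx ?ler01.
pose VB c G D H := expect_at_dbase D (S2 c G H D).
have VB01 c G D H : 0 <= VB c G D H <= 1 by apply: expect_at_dbase01 => y.
have S2E : avg (fun l => VA i u l (sel l) * (hit l)%:R) =
    avg (fun c => avg (fun G => avg (fun D => avg (VB c G D)))).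
  rewrite [LHS]avg_pair; apply: eq_avg => c.
  transitivity (expect (fun D y => avg (fun G => avg (fun H => S2 c G H D y)))).
    rewrite expect_by_query; apply: eq_avg => y.
    rewrite /VA -expect_at_queryZr; congr (_ * _); apply: eq_expect => D y'.
    congr (_ * _); rewrite -avgZr; apply: eq_avg => G; rewrite -avgZr.
    by apply: eq_avg.
  rewrite expect_avg; apply: eq_avg => G; rewrite expect_avg [RHS]exchange_avg.
  by apply: eq_avg => H; apply: expect_by_dbase.
(* The contents of all cells named in the [N] samples, seen as a message about the independent
   databases below the children. *)
pose LB (F : {ffun 'I_q.+1 -> dbase rs}) : {ffun 'I_N * 'I_r.1 -> W} :=
  [ffun ka => T (i, u, F) (tnth (LA0 i u (M ka.1)) ka.2)].
pose badB (c : 'I_q.+1) (G : {ffun 'I_q.+1 -> dbase rs}) D H :=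
  prob (fun w => LB (splice c G w) == LB (insert c G D H)) <
  (1 - eta) * prob (fun w => LB (insert c G D w) == LB (insert c G D H)) :> R.
have := @message_growth R _ _ _ F0 LB (1 - eta).
rewrite card_ffun card_prod !card_ord.
move=> /(_ ltac:(lra) ltac:(lra)).
rewrite -/(growth_bound _ _ _); set betaB := growth_bound _ _ _ => growthB.
have [c Hc] := avg_le_max (ord0 : 'I_q.+1) (fun c => avg (fun G => avg (fun D =>
  avg (fun H => VB c G D H - (badB c G D H)%:R)))).
have [G HG] := avg_le_max F0 (fun G => avg (fun D =>
  avg (fun H => VB c G D H - (badB c G D H)%:R))).
have {Hc HG} HB : avg (fun l => VA i u l (sel l) * (hit l)%:R) - betaB <=
    avg (fun D => avg (fun H => VB c G D H - (badB c G D H)%:R)).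
  apply: le_trans (le_trans Hc HG); rewrite S2E.
  apply: le_trans (lerB (lexx _) growthB) _; rewrite /prob.
  rewrite -avgB; apply: le_avg => c'; rewrite -avgB; apply: le_avg => G'.
  by rewrite -avgB; apply: le_avg => D; rewrite -avgB.
have [rsp [selH HselH]] := @exists_response R _ _ _ _ (dbase0 rs) F0 F0
  (fun D H => LB (insert c G D H)) (fun w => LB (splice c G w)) (VB c G)
  (VB01 c G) eta eta0' eta1'.
(* A table may depend on its whole database, so the databases below the children after [c] may be
   chosen as a function of [D]. *)
pose T' D := T (i, u, insert c G D (selH D)).
pose A' y : strategy rs :=
  let l := (c, y) in let a := A (insert i u l (sel l)) in
  if [pick k | LA0 i u (M k) == LA i u l (sel l)] is Some k
  then a.2 [tuple rsp (k, j) | j < r.1]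
  else a.2 [tuple T (i, u, F0) (tnth a.1 j) | j < r.1].
exists T', A'.
suff H : avg (fun D => VB c G D (selH D) * (LB (insert c G D (selH D)) == rsp)%:R)
    <= success T' A'.
  by move: HA Hsel HB HselH; rewrite -/(badA i u) -/(badB c G); lra.
rewrite /success expect_by_dbase; apply: le_avg => D.
rewrite -expect_at_dbaseZr; apply: le_expect_at_dbase => y.
rewrite /S2 /hit /A'.
case: pickP => [k /eqP hk|nohit]; last first.
  case: existsP => [[k]|_]; first by rewrite nohit.
  by rewrite mulr0 mul0r ler0n.
case: (LB _ =P rsp) => [resp|_]; last by rewrite mulr0 ler0n.
rewrite mulr1; apply: le_trans (_ : S i u c G (selH D) D y (sel (c, y)) <= _).
  have /andP[S_ge0 _] := S01 i u c G (selH D) D y (sel (c, y)).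
  by rewrite ler_piMr ?lern1 ?leq_b1.
rewrite /S /= -/(T' D).
have -> // : [tuple T' D (tnth (A (insert i u (c, y) (sel (c, y)))).1 j) | j < r.1] =
    [tuple rsp (k, j) | j < r.1].
by apply: eq_from_tnth => j; rewrite !tnth_mktuple -resp ffunE /= hk.
Qed.

End Strategy.
End Game.

(** * Databases as sets of paths *)

(** Rounds are removed one by one until the bit must be guessed, each at a cost of at most [e]. *)
Lemma elimination (R : realType) (q s : nat) (W : finType) (rs : seq (nat * nat))
    (K eta e : R) (N : nat) (T : dbase q rs -> 'I_s -> W)
    (A : query q rs -> strategy s W rs) :
  1 < K -> 0 < eta -> eta < 1 ->
  (forall r, r \in rs ->
    growth_bound (s ^ r.1) r.2.+1 K^-1 + eta + (1 - eta / K) ^+ N +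
    growth_bound (#|W| ^ (N * r.1)) q.+1 (1 - eta) + eta <= e) ->
  success T A <= 2^-1 + e * (size rs)%:R.
Proof.
move=> K1 eta0 eta1; elim: rs T A => [|r rs IH] T A rsP.
  by rewrite success_nil mulr0 addr0.
have [T' [A' H]] := elimination_step T A N K1 eta0 eta1.
apply: le_trans H _.
have := rsP r; rewrite mem_head => /(_ isT) He.
have := IH T' A' (fun r' r'rs => rsP r' ltac:(by rewrite inE r'rs orbT)).
have -> : (size (r :: rs))%:R = (size rs)%:R + 1 :> R by rewrite natr1.
lra.
Qed.

Section Tree.
Variable q : nat.
Local Notation query := (query q).
Local Notation dbase := (dbase q).

Fixpoint path_of rs : query rs -> seq 'I_q.+1 :=
  if rs is r :: rs' then fun x =>
    flatten [seq (x i).1 :: path_of (x i).2 | i <- enum 'I_r.2.+1]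
  else fun _ => [::].

(** Leaves may lie at different depths, since each subdatabase has its own position. *)
Fixpoint leaves rs : dbase rs -> seq (seq 'I_q.+1 * bool) :=
  if rs is r :: rs' then fun D =>
    flatten [seq [seq (flatten [seq (D.1.2 i).1 :: path_of (D.1.2 i).2 |
                                i <- take D.1.1 (enum 'I_r.2.+1)] ++ c :: l.1,
                       l.2) | l <- leaves (D.2 c)] | c <- enum 'I_q.+1]
  else fun b => [:: ([::], b)].

Fixpoint depth (rs : seq (nat * nat)) : nat :=
  if rs is r :: rs' then (r.2.+1 * (depth rs').+1)%N else 0.

Lemma size_path_of rs (x : query rs) : size (path_of x) = depth rs.
Proof.
elim: rs x => [|r rs IH] x //=.
rewrite size_flatten /shape -map_comp -[in RHS](size_enum_ord r.2.+1).
elim: (enum _) => //= i e ->; rewrite IH; lia.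
Qed.

Lemma size_leaves rs (D : dbase rs) : size (leaves D) = (q.+1 ^ size rs)%N.
Proof.
elim: rs D => [|r rs IH] D //=.
rewrite size_flatten /shape -map_comp expnS.
set m := (q.+1 ^ size rs)%N; rewrite -[in RHS](size_enum_ord q.+1).
elim: (enum 'I_q.+1) => //= c e ->; rewrite size_map IH; lia.
Qed.

(** Every pair that occurs in [expect] satisfies this. *)
Fixpoint compat rs : dbase rs -> query rs -> Prop :=
  if rs is r :: rs' then fun D x =>
    (forall a : 'I_r.2.+1, (a < D.1.1)%N -> x a = D.1.2 a) /\
    compat (D.2 (x D.1.1).1) (x D.1.1).2
  else fun _ _ => True.

Lemma le_expect_compat (R : realType) rs (f g : dbase rs -> query rs -> R) :
  (forall D x, compat D x -> f D x <= g D x) -> expect f <= expect g.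
Proof.
elim: rs f g => [|r rs IH] f g fg /=; first by apply: le_avg => b; apply: fg.
apply: le_avg => i; apply: le_avg => u; apply: le_avg => v; apply: le_avg => c.
apply: le_avg => G; apply: le_avg => H; apply: IH => D x Dx; apply: fg.
split=> [a ai|] /=; first by rewrite ffunE ai.
by rewrite !insert_at.
Qed.

(** The leaf [y] where the query path ends is the longest prefix match: a leaf that follows the path
    for [size y] symbols takes the same child at every level, and so carries the same bit. *)
Lemma leaves_target rs (D : dbase rs) (x : query rs) : compat D x ->
  exists y, [/\ (y, target D x) \in leaves D, (size y <= depth rs)%N,
    forall a, (a < size y)%N -> nth ord0 y a = nth ord0 (path_of x) a &
    forall z b, (z, b) \in leaves D ->
      (forall a, (a < size y)%N -> nth ord0 z a = nth ord0 (path_of x) a) ->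
      b = target D x].
Proof.
elim: rs D x => [|r rs IH] D x /=.
  move=> _; exists [::]; split=> //; first by rewrite inE.
  by move=> z b; rewrite inE => /eqP[].
set i := D.1.1; set u := D.1.2 => -[pre_eq /IH[y [y_leaf y_size y_pre y_uniq]]].
set pre := flatten [seq _ | j <- take i _].
have pathE : exists rest, flatten [seq (x j).1 :: path_of (x j).2 | j <- enum 'I_r.2.+1]
    = pre ++ (x i).1 :: path_of (x i).2 ++ rest.
  exists (flatten [seq (x j).1 :: path_of (x j).2 | j <- drop i.+1 (enum 'I_r.2.+1)]).
  rewrite -[in LHS](cat_take_drop i (enum 'I_r.2.+1)) map_cat flatten_cat.
  rewrite (drop_nth i) ?size_enum_ord ?ltn_ord // nth_ord_enum /=.
  congr (_ ++ _); congr flatten; apply/eq_in_map => j jin.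
  rewrite pre_eq //.
  have := jin; rewrite -(mem_map val_inj) map_take val_enum_ord.
  rewrite take_iota mem_iota add0n leq_min => /and3P[]//.
have := size_path_of (rs := r :: rs) x.
case: pathE => rest /= -> path_size.
exists (pre ++ (x i).1 :: y); split.
- apply/flatten_mapP; exists (x i).1; rewrite ?mem_enum //.
  by apply/mapP; exists (y, target (D.2 (x i).1) (x i).2).
- move: path_size; rewrite !(size_cat, size_path_of) /= size_cat size_path_of => <-.
  by rewrite leq_add2l ltnS (leq_trans y_size) ?leq_addr.
- move=> a; rewrite size_cat /= !nth_cat; case: (ltnP a (size pre)) => // pa ay.
  case e: (a - size pre)%N => [//|b] /=.
  have lt_by : (b < size y)%N by rewrite -ltnS -e ltn_subLR.
  by rewrite nth_cat size_path_of (leq_trans lt_by y_size) y_pre.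
move=> z b /flatten_mapP[c _ /mapP[[z' b'] z'_leaf [-> ->]]] agree.
have ec : c = (x i).1.
  have := agree (size pre); rewrite size_cat /= !nth_cat ltnn subnn /=; apply.
  lia.
move: z'_leaf; rewrite ec => /y_uniq; apply=> a ay.
have := agree (size pre + a.+1)%N; rewrite size_cat /= ltn_add2l ltnS ay => /(_ isT).
rewrite !nth_cat !ifN; try lia; rewrite addKn /= nth_cat size_path_of ifT //.
exact: leq_trans ay y_size.
Qed.

End Tree.

(** * Codes and the embedding of paths into the cube *)

Section Code.
Local Open Scope nat_scope.

Definition fdist (D : nat) (x y : {ffun 'I_D -> bool}) : nat :=
  \sum_i (x i != y i).

(* Each point of the ball contributes at least [2 ^ (7 * E)] to the generating
   function [\sum_y 2 ^ (8 * E - fdist x y) = 3 ^ (8 * E)]. *)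
Lemma ball_volume E (x : {ffun 'I_(8 * E) -> bool}) :
  #|[set y | fdist x y <= E]| * 2 ^ (7 * E) <= 3 ^ (8 * E).
Proof.
pose g (i : 'I_(8 * E)) (b : bool) := 2 ^ (x i == b).
have gen : \sum_(y : {ffun 'I_(8 * E) -> bool}) \prod_i g i (y i) = 3 ^ (8 * E).
  rewrite -(bigA_distr_bigA g) -[in RHS](card_ord (8 * E)) -prod_nat_const.
  by apply: eq_bigr => i _; rewrite big_bool /g; case: (x i).
rewrite -gen -sum_nat_const.
apply: leq_trans (_ : \sum_(y in [set y | fdist x y <= E]) \prod_i g i (y i) <= _).
  apply: leq_sum => y; rewrite inE => xy.
  rewrite -expn_sum leq_exp2l //.
  have : \sum_(i < 8 * E) ((x i == y i) + (x i != y i)) = 8 * E.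
    rewrite -[RHS](card_ord (8 * E)) -sum1_card; apply: eq_bigr => i _.
    by case: (x i == y i).
  by rewrite big_split /= -/(fdist x y); lia.
by rewrite [leqRHS](bigID (mem [set y | fdist x y <= E])) leq_addr.
Qed.

(** Gilbert-Varshamov: fewer than [4 ^ E] balls of radius [E] cannot cover the cube, because
    [4 * 3 ^ 8 = 26244 <= 32768 = 2 ^ 15]. *)
Lemma greedy_code E m : m <= 4 ^ E ->
  exists s : seq {ffun 'I_(8 * E) -> bool},
    size s = m /\ pairwise (fun x y => E < fdist x y) s.
Proof.
elim: m => [|m IH] mE; first by exists [::].
have [s [ss sP]] := IH (ltnW mE).
pose U := \bigcup_(x <- s) [set y | fdist x y <= E].
have U_small : #|U| < 2 ^ (8 * E).
  have : #|U| * 2 ^ (7 * E) <= m * 3 ^ (8 * E).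
    rewrite -ss /U; elim: (s) => [|x s' IHs]; first by rewrite big_nil cards0.
    rewrite big_cons; apply: leq_trans (leq_mul (leq_card_setU _ _) (leqnn _)) _.
    by rewrite mulnDl [size (x :: s')]/= [leqRHS]mulSn leq_add ?ball_volume.
  have H1 : m * 3 ^ (8 * E) < 4 ^ E * 3 ^ (8 * E).
    by rewrite ltn_pmul2r ?expn_gt0.
  have H2 : 4 ^ E * 3 ^ (8 * E) <= 2 ^ (8 * E) * 2 ^ (7 * E).
    rewrite !expnM -!expnMn; have [->|E0] := posnP E; first by rewrite !expn0.
    by rewrite leq_exp2r.
  move=> H0; rewrite -(ltn_pmul2r (m := 2 ^ (7 * E))) ?expn_gt0 //.
  exact: leq_ltn_trans H0 (leq_trans H1 H2).
have /existsP[y yU] : [exists y, y \notin U].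
  rewrite -negb_forall; apply: contraL U_small => /forallP allU.
  rewrite -leqNgt (_ : 2 ^ (8 * E) = #|{ffun 'I_(8 * E) -> bool}|).
    by apply/subset_leq_card/subsetP => y _; apply: allU.
  by rewrite card_ffun card_bool card_ord.
exists (rcons s y); rewrite size_rcons ss; split=> //.
rewrite pairwise_rcons sP andbT; apply/allP => x xs.
apply: contraR yU; rewrite -leqNgt => xy.
by rewrite /U (big_rem x xs) /= !inE xy.
Qed.

Fixpoint sdist (s1 s2 : seq bool) : nat :=
  match s1, s2 with
  | a :: s1', b :: s2' => (a != b) + sdist s1' s2'
  | _, _ => 0
  end.

Lemma sdist_refl s : sdist s s = 0.
Proof. by elim: s => //= a s ->; rewrite eqxx. Qed.

Lemma sdist_cat s1 s2 t1 t2 : size s1 = size t1 ->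
  sdist (s1 ++ s2) (t1 ++ t2) = sdist s1 t1 + sdist s2 t2.
Proof. by elim: s1 t1 => [|a s IH] [|b t] //= [] /IH ->; rewrite addnA. Qed.

Lemma sdist_le s t : sdist s t <= size s.
Proof.
elim: s t => [|a s IH] [|b t] //=; rewrite -add1n leq_add ?IH //.
by case: eqP.
Qed.

Lemma sdist_mkseq D (f g : nat -> bool) :
  sdist (mkseq f D) (mkseq g D) = \sum_(i < D) (f i != g i).
Proof.
elim: D f g => [|D IH] f g; first by rewrite big_ord0.
rewrite big_ord_recl.
transitivity ((f 0 != g 0) + sdist (mkseq (f \o S) D) (mkseq (g \o S) D)).
  by rewrite /mkseq /= (iotaDl 1 0) -!map_comp.
by rewrite IH.
Qed.

Lemma hamming_sdist d s t : size s = size t -> size s <= d ->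
  hamming [tuple nth false s i | i < d] [tuple nth false t i | i < d] = sdist s t.
Proof.
move=> st sd; rewrite /hamming -sum1dep_card big_mkcond /=.
transitivity (\sum_(i < d) (nth false s i != nth false t i)).
  by apply: eq_bigr => i _; rewrite !tnth_mktuple; case: eqP.
rewrite -sdist_mkseq -[in RHS](mkseq_nth false s) -[in RHS](mkseq_nth false t) -st.
rewrite !sdist_mkseq -(big_mkord predT (fun i => (nth false s i != nth false t i) : nat)).
rewrite (big_cat_nat (n := size s)) //= big_mkord -[RHS]addn0; congr (_ + _).
rewrite big_nat_cond big1 // => i /andP[/andP[si _] _].
by rewrite !nth_default -?st // eqxx.
Qed.

Lemma exists_code E m : m < 4 ^ E ->
  exists C : 'I_m.+1 -> seq bool,
    (forall c, size (C c) = 8 * E) /\ (forall c c', c != c' -> E < sdist (C c) (C c')).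
Proof.
move=> mE; have [s [ss /(pairwiseP [ffun=> false]) sP]] := greedy_code mE.
pose w (c : 'I_m.+1) := nth [ffun=> false] s c.
pose C c := codom (w c).
have CE c : C c = codom (w c) by [].
have Cdist c c' : sdist (C c) (C c') = fdist (w c) (w c').
  rewrite /C !codomE; rewrite /fdist.
  rewrite -big_enum /=; elim: (enum _) => [|i e IH]; first by rewrite big_nil.
  by rewrite big_cons /= IH.
have fdistC x y : @fdist (8 * E) x y = fdist y x.
  by apply: eq_bigr => i _; rewrite eq_sym.
exists C; split=> [c|c c' cc']; first by rewrite size_codom card_ord.
rewrite Cdist; have := cc'; rewrite -val_eqE neq_ltn => /orP[] lt_cc'.
  by apply: sP; rewrite ?inE ?ss ?ltn_ord.
by rewrite fdistC; apply: sP; rewrite ?inE ?ss ?ltn_ord.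
Qed.

End Code.

Section Embedding.
Local Open Scope ring_scope.
Context {R : realType} (gamma : R) (E r m : nat).
Variable code : nat -> 'I_m.+1 -> seq bool.
Hypothesis gamma0 : 0 <= gamma.
Hypothesis gammaE : gamma <= E%:R.
Hypothesis gamma_r : 8 * gamma + 1 <= r%:R.
Hypothesis size_code : forall j c, size (code j c) = (8 * (E * r ^ j))%N.
Hypothesis code_far : forall j c c', c != c' ->
  (E * r ^ j < sdist (code j c) (code j c'))%N.

(* Level [j] of the tree is encoded by [8 * E * r ^ j] bits, so that the lengths
   of all lower levels together do not reach [1 / gamma] of the distance between
   two code words of level [j]. *)
Fixpoint embed J (sigma : nat -> 'I_m.+1) (b : bool) : seq bool :=
  if J is J'.+1 then code J' (sigma 0) ++ embed J' (sigma \o S) b else [:: b].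

Fixpoint embed_size J : nat :=
  if J is J'.+1 then (8 * (E * r ^ J') + embed_size J')%N else 1.

Lemma embed_size_gt0 J : (0 < embed_size J)%N.
Proof. by elim: J => //= J; rewrite addn_gt0 orbC => ->. Qed.

Lemma size_embed J sigma b : size (embed J sigma b) = embed_size J.
Proof.
by elim: J sigma => [|J IH] sigma //=; rewrite size_cat size_code IH.
Qed.

(** Geometric growth: level [J] adds [8 * gamma * E * r ^ J] to at most [E * r ^ J], and
    [8 * gamma + 1 <= r]. *)
Lemma gamma_embed_size J : gamma * (embed_size J)%:R <= (E * r ^ J)%:R.
Proof.
elim: J => [|J IH] /=; first by rewrite mulr1 muln1.
rewrite natrD mulrDr (natrM _ 8).
have -> : (E * r ^ J.+1 = E * r ^ J * r)%N by rewrite expnSr mulnA.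
rewrite (natrM _ (E * r ^ J) r).
have e0 : 0 <= (E * r ^ J)%:R :> R by rewrite ler0n.
have := ler_wpM2l e0 gamma_r; lra.
Qed.

Lemma embed_close J l sigma sigma' b b' : (l <= J)%N ->
  (forall a, (a < l)%N -> sigma a = sigma' a) ->
  gamma * (sdist (embed J sigma b) (embed J sigma' b'))%:R <= (E * r ^ (J - l))%:R.
Proof.
elim: l J sigma sigma' => [|l IH] J sigma sigma' lJ agree.
  rewrite subn0; apply: le_trans (gamma_embed_size J).
  by rewrite ler_wpM2l // ler_nat -(size_embed J sigma b) sdist_le.
case: J lJ => // J lJ; rewrite subSS /= sdist_cat ?size_code //.
by rewrite agree // sdist_refl add0n; apply: IH => // a al; apply: agree.
Qed.

(** Against [embed_close]: deviating before position [l] puts a point more than [gamma] times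
    farther away than agreeing on the first [l] symbols. *)
Lemma embed_far J l sigma sigma' b b' : (l < J)%N -> sigma l != sigma' l ->
  (E * r ^ (J - l.+1) < sdist (embed J sigma b) (embed J sigma' b'))%N.
Proof.
elim: l J sigma sigma' => [|l IH] [|J] sigma sigma' //= lJ ne.
  rewrite subSS subn0 sdist_cat ?size_code //; apply: ltn_addr; exact: code_far.
by rewrite subSS sdist_cat ?size_code //; apply: ltn_addl; apply: IH.
Qed.

Lemma last_embed J sigma b : nth false (embed J sigma b) (embed_size J).-1 = b.
Proof.
rewrite -(size_embed J sigma b) nth_last.
by elim: J sigma {1}false => [|J IH] sigma b0 //=; rewrite last_cat IH.
Qed.

End Embedding.

(** * Reduction to nearest neighbour search *)

Lemma zip_mktuple (T U : Type) n (t : n.-tuple T) (f : T -> U) :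
  zip t [tuple f (tnth t j) | j < n] = [seq (a, f a) | a <- t].
Proof.
have -> : tval [tuple f (tnth t j) | j < n] = [seq f a | a <- t].
  by rewrite -[in RHS](map_tnth_enum t) -map_comp.
by elim: (tval t) => //= a l ->.
Qed.

Section Unfold.
Context {d s w k : nat} {ts : 'I_k -> nat} (pp : 'I_k -> nat).
Variables (dec : cube d -> bool) (A : algorithm d s w ts) (x : cube d).

(** The transcript is accumulated in [h], since each [lookup] reads all earlier rounds, whereas a
    strategy passes on one round at a time. *)
Fixpoint unfold_algorithm (rds : seq 'I_k) (h : transcript s w) :
    strategy s (w.-tuple bool) [seq (ts i, pp i) | i <- rds] :=
  match rds return strategy s (w.-tuple bool) [seq (ts i, pp i) | i <- rds] with
  | [::] => dec (output A x h)
  | i :: rds' => (lookup A i x h,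
     fun ans : (ts i).-tuple (w.-tuple bool) =>
       unfold_algorithm rds' (h ++ zip (lookup A i x h) ans))
  end.

Lemma run_unfold (T : contents s w) rds h :
  run T (unfold_algorithm rds h) =
  dec (output A x (foldl (run_round A T x) h rds)).
Proof.
elim: rds h => [|i rds IH] h //=; rewrite IH /run_round.
congr (dec (output A x (foldl _ (_ ++ _) _))).
exact: zip_mktuple.
Qed.

End Unfold.

Section Reduction.
Context {R : realType} (gamma : R) (E r n q d : nat).
Hypothesis gamma1 : 1 < gamma.
Hypothesis gammaE : gamma <= E%:R.
Hypothesis gamma_r : 8 * gamma + 1 <= r%:R.
Hypothesis n_small : (n < 4 ^ E)%N.
Hypothesis qn : (q <= n)%N.
Variable rs : seq (nat * nat).
Hypothesis leaves_n : (q.+1 ^ size rs <= n)%N.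
Local Notation J := (depth rs).+1.
Hypothesis J_d : (E * r ^ J <= d)%N.

Let r_gt0 : (0 < r)%N.
Proof. by rewrite -(ltr0n R); have := gamma_r; have := gamma1; lra. Qed.

Lemma exists_level_codes : exists code : nat -> 'I_n.+1 -> seq bool,
  (forall j c, size (code j c) = (8 * (E * r ^ j))%N) /\
  (forall j c c', c != c' -> (E * r ^ j < sdist (code j c) (code j c'))%N).
Proof.
have /boolp.choice[code codeP] (j : nat) : exists C : 'I_n.+1 -> seq bool,
    (forall c, size (C c) = 8 * (E * r ^ j))%N /\
    (forall c c', c != c' -> E * r ^ j < sdist (C c) (C c'))%N.
  apply: exists_code; apply: leq_trans n_small _.
  by rewrite leq_exp2l // leq_pmulr // expn_gt0 r_gt0.
by exists code; split=> j; case: (codeP j).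
Qed.

Variable code : nat -> 'I_n.+1 -> seq bool.
Hypothesis size_code : forall j c, size (code j c) = (8 * (E * r ^ j))%N.
Hypothesis code_far : forall j c c', c != c' ->
  (E * r ^ j < sdist (code j c) (code j c'))%N.

Let gamma0 : 0 <= gamma.
Proof. by have := gamma1; lra. Qed.

(* The top symbol is [ord0] on the tree and nonzero on the padding points. *)
Definition symbols (c : 'I_n.+1) (y : seq 'I_q.+1) (a : nat) : 'I_n.+1 :=
  if a is a'.+1 then inord (nth ord0 y a') else c.

Definition point c y b : cube d :=
  [tuple nth false (embed code J (symbols c y) b) i | i < d].

Let size_le_d : (embed_size E r J <= d)%N.
Proof.
rewrite -(ler_nat R); apply: le_trans (_ : (E * r ^ J)%:R <= _); last by rewrite ler_nat.
apply: le_trans (gamma_embed_size gammaE gamma_r J).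
by rewrite ler_peMl ?ler0n // ltW.
Qed.

Lemma hamming_point c y b c' y' b' : hamming (point c y b) (point c' y' b') =
  sdist (embed code J (symbols c y) b) (embed code J (symbols c' y') b').
Proof. by apply: hamming_sdist; rewrite !(size_embed size_code). Qed.

Lemma last_point c y b : nth false (point c y b) (embed_size E r J).-1 = b.
Proof.
have lt_d : ((embed_size E r J).-1 < d)%N by rewrite prednK ?embed_size_gt0.
rewrite -(tnth_nth false _ (Ordinal lt_d)) tnth_mktuple /=.
exact: (last_embed size_code J).
Qed.

Definition tree_points (D : dbase q rs) : {set cube d} :=
  [set:: [seq point ord0 l.1 l.2 | l <- leaves D]].

(** These points fill the database up to exactly [n] elements; their top symbols keep them apart
    from each other and far from the tree. *)
Definition pads : seq (cube d) :=
  [seq point (lift ord0 c) [::] false | c <- enum 'I_n].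

Definition points D : {set cube d} :=
  tree_points D :|: [set:: take (n - #|tree_points D|) pads].

Lemma top_far c y b c' y' b' : c != c' ->
  (E * r ^ depth rs < hamming (point c y b) (point c' y' b'))%N.
Proof.
move=> cc'; rewrite hamming_point.
have := @embed_far _ _ _ _ size_code code_far J 0 (symbols c y) (symbols c' y') b b'.
by rewrite subSS subn0; apply.
Qed.

Lemma hamming_refl (x : cube d) : hamming x x = 0%N.
Proof. by apply/eqP; rewrite cards_eq0; apply/eqP/setP => i; rewrite !inE eqxx. Qed.

Lemma card_points D : #|points D| = n.
Proof.
have tree_le : (#|tree_points D| <= n)%N.
  apply: leq_trans leaves_n; rewrite -(size_leaves D).
  rewrite -(size_map (fun l => point ord0 l.1 l.2)).
  by rewrite cardsE card_size.
have uniq_pads : uniq pads.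
  rewrite map_inj_uniq ?enum_uniq // => c c' e.
  apply/eqP; apply: contraT => cc'.
  have := @top_far (lift ord0 c) [::] false (lift ord0 c') [::] false.
  by rewrite (inj_eq lift_inj) e hamming_refl => /(_ cc').
rewrite cardsU disjoint_setI0 ?cards0 ?subn0.
  rewrite [X in (_ + X)%N]cardsE (card_uniqP _) ?take_uniq // size_take.
  rewrite size_map size_enum_ord; case: ltnP; lia.
rewrite disjoint_subset; apply/subsetP => z.
rewrite !inE => /mapP[l _ ->]; apply/negP => /mem_take/mapP[c _ e].
have := @top_far ord0 l.1 l.2 (lift ord0 c) [::] false.
by rewrite e hamming_refl => /(_ (neq_lift _ _)).
Qed.

(** The leaf on the query path is so close that no point deviating earlier, nor any padding point,
    is a correct answer. The answer thus encodes a leaf through which [y_uniq] applies, and its last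
    encoded bit is the target. *)
Lemma correct_answer_bit D x z : compat D x ->
  anns_correct gamma (points D) (point ord0 (path_of x) false) z ->
  nth false z (embed_size E r J).-1 = target D x.
Proof.
move=> /leaves_target[y [y_leaf y_size y_agree y_uniq]] /andP[z_pt].
move=> /forall_inP/(_ (point ord0 y (target D x))).
have -> : point ord0 y (target D x) \in points D.
  by rewrite !inE (map_f (fun l => point ord0 l.1 l.2) y_leaf).
move=> /(_ isT) z_close.
(* The successor in [(size y).+1] accounts for the top symbol. *)
have {}z_close : (hamming (point ord0 (path_of x) false) z <=
    E * r ^ (J - (size y).+1))%N.
  rewrite -(ler_nat R); apply: le_trans z_close _; rewrite hamming_point.
  apply: embed_close => //.
  by case=> [|a] //=; rewrite ltnS => /y_agree ->.
move: z_pt; rewrite !inE.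
case/orP=> [/mapP[[zp zb] z_leaf ze]|/mem_take/mapP[c _ ze]]; last first.
  have := @top_far ord0 (path_of x) false (lift ord0 c) [::] false (neq_lift _ _).
  rewrite -ze ltnNge (leq_trans z_close) //.
  by rewrite leq_mul2l subSS leq_pexp2l ?leq_subr ?orbT.
rewrite ze last_point; apply: y_uniq z_leaf _ => a ay; apply/eqP/negPn/negP => ne.
have := @embed_far _ _ _ _ size_code code_far J a.+1 (symbols ord0 (path_of x))
  (symbols ord0 zp) false zb.
rewrite ltnS (leq_trans ay y_size) subSS -hamming_point -ze => /(_ isT).
have -> : symbols ord0 (path_of x) a.+1 != symbols ord0 zp a.+1.
  apply: contra ne => /eqP/(congr1 val) /=.
  have ltq (c : 'I_q.+1) : (c < n.+1)%N by rewrite ltnS (leq_trans _ qn) // -ltnS.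
  by rewrite !inordK // => /val_inj ->.
move=> /(_ isT); rewrite ltnNge (leq_trans z_close) //.
by rewrite leq_mul2l leq_pexp2l ?orbT // !subSS leq_sub2l.
Qed.

End Reduction.

(** The table is the same for all seeds, so on the hard distribution some seed does at least as well
    as the average. *)
Lemma success_of_scheme (R : realType) (gamma : R) (E r n q d s w k : nat)
    (ts pp : 'I_k -> nat) (S : randomized_scheme R d s w ts) :
  let rs := [seq (ts i, pp i) | i <- enum 'I_k] in
  1 < gamma -> gamma <= E%:R -> 8 * gamma + 1 <= r%:R -> (n < 4 ^ E)%N ->
  (q <= n)%N -> (q.+1 ^ k <= n)%N -> (E * r ^ (depth rs).+1 <= d)%N ->
  (forall B : {set cube d}, #|B| = n ->
   forall x : cube d, 7 / 8 <= success_prob gamma S B x) ->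
  exists (T : dbase q rs -> 'I_s -> w.-tuple bool)
         (A : query q rs -> strategy s (w.-tuple bool) rs),
    7 / 8 <= success T A :> R.
Proof.
move=> rs gamma1 gammaE gamma_r nE qn qk Jd correct.
have leaves_n : (q.+1 ^ size rs <= n)%N by rewrite size_map size_enum_ord.
have [code [size_code code_far]] := exists_level_codes gamma1 gamma_r nE.
pose pt (x : query q rs) := point d rs code ord0 (path_of x) false.
pose dec (z : cube d) := nth false z (embed_size E r (depth rs).+1).-1.
pose A rho (x : query q rs) :=
  unfold_algorithm pp dec (algo S rho) (pt x) (enum 'I_k) [::].
pose T (D : dbase q rs) : 'I_s -> w.-tuple bool := table S (points d code D).
have le_sum : 7 / 8 <= \sum_rho seed_prob S rho * success T (A rho).
  under eq_bigr do rewrite -expectZl; rewrite -expect_sum.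
  rewrite -[leLHS](avg_cst (query0 q rs)) -expect_query.
  apply: le_expect_compat => D x Dx.
  apply: le_trans (correct (points d code D) _ (pt x)) _.
    exact (card_points gamma1 gammaE gamma_r nE qn leaves_n Jd size_code code_far D).
  rewrite /success_prob big_mkcond; apply: ler_sum => rho _.
  have p0 := seed_prob_ge0 rho.
  case: ifP => [ok|_]; last by rewrite mulr_ge0.
  rewrite /A run_unfold -/(answer _ _ _) /dec.
  rewrite (correct_answer_bit gamma1 gammaE gamma_r qn Jd size_code code_far Dx ok).
  by rewrite eqxx mulr1.
have [rho0 _|no_seed] := pickP (predT : pred (seed S)); last first.
  have := seed_prob_sum1 S; rewrite big_pred0; last exact: no_seed.
  by move/eqP; rewrite eq_sym oner_eq0.
case: (arg_maxP (fun rho => success T (A rho) : R) (erefl (predT rho0))) => rho _ rho_max.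
exists T, (A rho); apply: le_trans le_sum _.
rewrite -[leRHS]mul1r -(seed_prob_sum1 S) mulr_suml; apply: ler_sum => rho' _.
by rewrite ler_wpM2l ?seed_prob_ge0 //; apply: rho_max.
Qed.

(** * Estimates *)

Section Estimates.
Context {R : realType}.
Implicit Types (x u eta K : R).

Lemma ln2_ge : 1 / 2 <= ln 2 :> R.
Proof.
have := @ln_le_sub1 R (2^-1); rewrite invr_gt0 ltr0n => /(_ isT).
by rewrite lnV ?posrE ?ltr0n //; lra.
Qed.

Lemma ln2_le : ln 2 <= 1 :> R.
Proof. by have := @ln_le_sub1 R 2; rewrite ltr0n => /(_ isT); lra. Qed.

(* [- ln u = - 2 ln (sqrt u) >= 2 (1 - sqrt u)], so the left-hand side below is
   at least [(1 - sqrt (1 - eta)) ^ 2]. *)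
Lemma ln_loss_quadratic eta : 0 < eta -> eta < 1 ->
  eta ^+ 2 / 4 <= (1 - eta) - 1 - ln (1 - eta).
Proof.
move=> eta0 eta1; set v := Num.sqrt (1 - eta).
have v2 : v ^+ 2 = 1 - eta by rewrite sqr_sqrtr // subr_ge0 ltW.
have v0 : 0 < v by rewrite sqrtr_gt0 subr_gt0.
have lnv : ln (1 - eta) = ln v *+ 2 by rewrite -v2 lnXn.
have := ln_le_sub1 v0; rewrite lnv mulr2n => H.
have vle : v <= 1 - eta / 2.
  rewrite -(@ler_pXn2r _ 2) ?nnegrE //; try lra.
  by rewrite v2; nra.
nra.
Qed.

Lemma le_expRN x : 0 < x -> expR (- x) <= x^-1.
Proof.
move=> x0; rewrite expRN lef_pV2 ?posrE ?expR_gt0 //.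
by apply: le_trans (expR_ge1Dx x); lra.
Qed.

Lemma exp_decay u N : u <= 1 -> (1 - u) ^+ N <= expR (- (u * N%:R)).
Proof.
move=> u1; rewrite -mulNr expRM_natr.
by apply: lerXn2r; rewrite ?nnegrE ?expR_ge0 ?subr_ge0 // expR_ge1Dx.
Qed.

Lemma depth_le_prod rs : ((depth rs).+1 <= \prod_(r <- rs) (2 * r.2.+1))%N.
Proof.
elim: rs => [|r rs IH]; first by rewrite big_nil.
by rewrite big_cons /=; nia.
Qed.

(** Arithmetic-geometric mean inequality for the [k] factors [4 * C * k ^ 2 * (ts i).+1]. The
    successor keeps rounds without probes from giving [0], at the price of the term [k] in
    [t + k]. *)
Lemma depth_bound k C (ts : 'I_k -> nat) t : (\sum_(i < k) ts i)%N = t -> (0 < C)%N ->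
  ((depth [seq (ts i, C * k ^ 2 * (ts i).+1)%N | i <- enum 'I_k]).+1 <=
   (4 * C * k * (t + k)) ^ k)%N.
Proof.
move=> <- C0; apply: leq_trans (depth_le_prod _) _.
rewrite big_map big_enum /=.
apply: leq_trans (_ : \prod_(i < k) (4 * C * k * (ts i).+1 * k) <= _)%N.
  apply: leq_prod => i _; have := ltn_ord i; nia.
rewrite -(ler_nat int) natr_prod natrX.
have E0 : {in predT, forall i : 'I_k, 0 <= (4 * C * k * (ts i).+1)%:R *+ #|'I_k| :> int}.
  by move=> i _; rewrite mulrn_wge0 ?ler0n.
have [+ _] := leif_AGM_scaled E0.
rewrite card_ord.
have -> : \sum_(i < k) (4 * C * k * (ts i).+1)%:R =
    (4 * C * k * (\sum_(i < k) ts i + k))%:R :> int.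
  rewrite -natr_sum; congr _%:R; rewrite -big_distrr /=; congr (_ * _)%N.
  have k_sum : (\sum_(i < k) 1 = k)%N by rewrite sum1_card card_ord.
  rewrite -[X in (_ = _ + X)%N]k_sum -big_split.
  by apply: eq_bigr => i _; rewrite /= addn1.
by under eq_bigr do rewrite -mulrnA.
Qed.


Lemma ln_natX s t : ln (s ^ t)%:R = t%:R * ln s%:R :> R.
Proof.
case: s => [|s]; last by rewrite natrX lnXn ?ltr0n // mulr_natl.
case: t => [|t]; first by rewrite expn0 ln1 mul0r.
by rewrite exp0n // ln0 // mulr0.
Qed.

(** Here [M] is [ln n]. At most [t * c * M] of information, over more than [C * k ^ 2 * t] blocks,
    is divided by a loss of at least [ln K / 2 = M / (8 * k)]; so [128 * c <= C] gives
    [1 / (16 * k)]. *)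
Lemma growth_query c K M s t k C : 0 < c -> (0 < k)%N -> 0 < K ->
  ln K = M / (4 * k%:R) -> 2 <= ln K -> ln s%:R <= c * M -> 128 * c <= C%:R ->
  growth_bound (s ^ t) (C * k ^ 2 * t.+1).+1 K^-1 <= (16 * k%:R)^-1.
Proof.
move=> c0 k0 K0 lnK K_big s_le C_ge; rewrite /growth_bound lnV ?posrE // ln_natX.
have k0' : 0 < k%:R :> R by rewrite ltr0n.
have Kinv : 0 < K^-1 by rewrite invr_gt0.
have M_eq : M = ln K * (4 * k%:R) by rewrite lnK mulfVK // gt_eqF // mulr_gt0.
have den : ln K / 2 <= K^-1 - 1 - - ln K by lra.
have den0 : 0 < K^-1 - 1 - - ln K by lra.
rewrite ler_pdivrMr // ler_pdivrMr ?ltr0n //.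
apply: le_trans (_ : t%:R * (c * M) <= _); first by rewrite ler_wpM2l ?ler0n.
apply: le_trans (_ : (16 * k%:R)^-1 * (ln K / 2) * (128 * c * k%:R ^+ 2 * t%:R) <= _).
  rewrite M_eq; have -> : (16 * k%:R)^-1 * (ln K / 2) * (128 * c * k%:R ^+ 2 * t%:R) =
    t%:R * (c * (ln K * (4 * k%:R))) by field; rewrite gt_eqF.
  by [].
have p_ge : 128 * c * k%:R ^+ 2 * t%:R <= (C * k ^ 2 * t.+1).+1%:R.
  apply: le_trans (_ : (C * k ^ 2 * t.+1)%:R <= _); last by rewrite ler_nat.
  rewrite (natrM _ (C * k ^ 2)) (natrM _ C) natrX.
  apply: ler_pM; rewrite ?ler_nat // ?mulr_ge0 ?exprn_ge0 //; try lra.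
  by rewrite ler_wpM2r // exprn_ge0 // ltW.
apply: ler_pM p_ge; rewrite ?mulr_ge0 ?invr_ge0 ?exprn_ge0 //; try lra.
by rewrite ler_wpM2l // invr_ge0; lra.
Qed.

(** With [eta = a^-1] the loss is at least [1 / (4 * a ^+ 2)], and the information per child is at
    most [4 * a ^+ 2 * t * w / K]. *)
Lemma growth_table K a w t N q : 1 < a -> 0 < K ->
  N%:R <= 2 * a ^+ 2 * K -> K ^+ 2 / 2 <= q%:R ->
  16 * a ^+ 5 * (t%:R * w%:R) <= K ->
  growth_bound ((2 ^ w) ^ (N * t)) q (1 - a^-1) <= a^-1.
Proof.
move=> a1 K0 N_le q_ge K_ge; rewrite /growth_bound !ln_natX.
have a0 : 0 < a by lra.
have eta0 : 0 < a^-1 by rewrite invr_gt0.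
have eta1 : a^-1 < 1 by rewrite invf_lt1.
have den := ln_loss_quadratic eta0 eta1.
have den0 : 0 < (1 - a^-1) - 1 - ln (1 - a^-1).
  by apply: lt_le_trans den; rewrite divr_gt0 ?exprn_gt0.
have q0 : 0 < q%:R :> R by apply: lt_le_trans q_ge; rewrite divr_gt0 ?exprn_gt0.
rewrite ler_pdivrMr // ler_pdivrMr // natrM.
have tw0 : 0 <= t%:R * w%:R :> R by rewrite mulr_ge0 ?ler0n.
apply: le_trans (_ : 2 * a ^+ 2 * K * (t%:R * w%:R) <= _).
  rewrite -mulrA; apply: ler_pM; rewrite ?ler0n ?mulr_ge0 ?ler0n //.
    by have := ln2_ge; lra.
  by rewrite ler_wpM2l ?ler0n // ler_piMr ?ler0n // ln2_le.
apply: le_trans (_ : a^-1 * (a^-1 ^+ 2 / 4) * (K ^+ 2 / 2) <= _); last first.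
  apply: ler_pM q_ge; rewrite ?divr_ge0 ?mulr_ge0 ?exprn_ge0 ?(ltW eta0) //; try lra.
  by rewrite ler_wpM2l // ltW.
have -> : a^-1 * (a^-1 ^+ 2 / 4) * (K ^+ 2 / 2) = (8 * a ^+ 3)^-1 * (K * K).
  by field; rewrite gt_eqF.
rewrite ler_pdivlMl ?mulr_gt0 ?exprn_gt0 //.
have -> : 8 * a ^+ 3 * (2 * a ^+ 2 * K * (t%:R * w%:R)) =
    16 * a ^+ 5 * (t%:R * w%:R) * K by ring.
by rewrite ler_pM2r.
Qed.


Lemma no_scheme (gamma c K : R) (E r C n q d s w t k : nat) (ts : 'I_k -> nat)
    (S : randomized_scheme R d s w ts) :
  1 < gamma -> gamma <= E%:R -> 8 * gamma + 1 <= r%:R -> (n < 4 ^ E)%N ->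
  (0 < k)%N -> (q.+1 ^ k <= n)%N -> (\sum_(i < k) ts i)%N = t -> (0 < C)%N ->
  (E * r ^ ((4 * C * k * (t + k)) ^ k) <= d)%N ->
  0 < c -> 128 * c <= C%:R -> 0 < K -> ln K = ln n%:R / (4 * k%:R) -> 2 <= ln K ->
  ln s%:R <= c * ln n%:R -> K ^+ 2 / 2 <= q.+1%:R ->
  16 * (16 * k%:R) ^+ 5 * (t%:R * w%:R) <= K ->
  ~ (forall B : {set cube d}, #|B| = n ->
     forall x : cube d, 7 / 8 <= success_prob gamma S B x).
Proof.
move=> gamma1 gammaE gamma_r nE k0 qk ts_t C0 d_ge c0 C_ge K0 lnK lnK2 s_le q_ge K_ge.
set a : R := 16 * k%:R in K_ge; pose pp i := (C * k ^ 2 * (ts i).+1)%N.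
have k1 : 1 <= k%:R :> R by rewrite ler1n.
have a16 : 16 <= a by rewrite /a; lra.
have a0 : 0 < a by lra.
have K1 : 1 < K by rewrite -(lnK_eq K) in K0; rewrite -(eqP K0) expR_gt1; lra.
have qn : (q <= n)%N.
  apply: leq_trans qk; apply: leq_trans (leqnSn q) _.
  by rewrite -{1}(expn1 q.+1) leq_pexp2l.
have r0 : (0 < r)%N by rewrite -(ltr0n R); lra.
have Jd : (E * r ^ (depth [seq (ts i, pp i) | i <- enum 'I_k]).+1 <= d)%N.
  by apply: leq_trans d_ge; rewrite leq_mul2l leq_pexp2l ?orbT // depth_bound.
case/(success_of_scheme gamma1 gammaE gamma_r nE qn qk Jd) => T [A].
apply/negP; rewrite -ltNge.
(* With [eta = a^-1] this makes [(eta / K) * N] at least [a], so all samples miss with probability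
   at most [expR (- a) <= a^-1]. *)
pose N := (Num.truncn (a ^+ 2 * K)).+1.
have a2K : 1 <= a ^+ 2 * K.
  by rewrite -[1]mulr1; apply: ler_pM; rewrite ?ler01 ?(ltW K1) // exprn_ege1 //; lra.
have [N_ge N_le] : a ^+ 2 * K <= N%:R /\ N%:R <= 2 * a ^+ 2 * K.
  have /andP[H1 H2] := truncn_itv (le_trans ler01 a2K).
  by split; rewrite ?(ltW H2) // /N -natr1; lra.
have ainv0 : 0 < a^-1 by rewrite invr_gt0.
have ainv1 : a^-1 < 1 by rewrite invf_lt1; lra.
apply: le_lt_trans (elimination (e := 5 * a^-1) (N := N) T A K1 ainv0 ainv1 _) _.
  move=> _ /mapP[i _ ->] /=; rewrite card_tuple card_bool.
  have HA := growth_query (ts i) c0 k0 K0 lnK lnK2 s_le C_ge.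
  have HB : growth_bound ((2 ^ w) ^ (N * ts i)) q.+1 (1 - a^-1) <= a^-1.
    apply: growth_table N_le q_ge _ => //; first by lra.
    apply: le_trans K_ge; rewrite ler_wpM2l ?mulr_ge0 ?exprn_ge0 ?(ltW a0) //.
    rewrite ler_wpM2r ?ler0n // ler_nat -ts_t.
    by rewrite (bigD1 i) //= leq_addr.
  have HC : (1 - a^-1 / K) ^+ N <= a^-1.
    apply: le_trans (exp_decay _ _) _.
      by rewrite ler_pdivrMr //; lra.
    apply: le_trans (le_expRN a0); rewrite ler_expR lerN2.
    rewrite mulrAC ler_pdivlMr // ler_pdivlMl //.
    by apply: le_trans N_ge; rewrite expr2 mulrA.
  by rewrite -/a in HA; rewrite -/(pp i); lra.
(* Five losses of [1 / (16 * k)] in each of [k] rounds leave [1 / 2 + 5 / 16 = 13 / 16 < 7 / 8]. *)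
rewrite size_map size_enum_ord -mulrA.
have -> : a^-1 * k%:R = 16^-1 by rewrite /a; field; rewrite gt_eqF //; lra.
lra.
Qed.

End Estimates.

(** * Asymptotics *)

Section Asymptotics.
Context {R : realType}.
Implicit Types (x u y z L X gamma kap : R).

Lemma log2_gt0_exp u : 0 < log2 u -> u = expR (ln 2 * log2 u).
Proof.
have l2 := @ln2_ge R; rewrite /log2 /logb => H.
have u0 : 0 < u.
  by rewrite ltNge; apply: contraTN H => u0; rewrite ln0 // mul0r ltxx.
by rewrite mulrC mulfVK ?lnK // gt_eqF; lra.
Qed.

Lemma le_log2 x u : 2 `^ x <= u -> x <= log2 u.
Proof.
have l2 := @ln2_ge R; move=> xu.
have p0 : 0 < 2 `^ x by apply: powR_gt0.
rewrite /log2 /logb ler_pdivlMr; last by lra.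
by rewrite -ln_powR ler_ln ?posrE // (lt_le_trans p0).
Qed.

Lemma log2_unbounded x : exists N : nat, forall d : nat, (N <= d)%N ->
  x <= log2 (log2 (log2 d%:R)).
Proof.
exists (Num.truncn (2 `^ (2 `^ (2 `^ x)))).+1 => d Nd.
do 3![apply: le_log2].
apply: le_trans (_ : (Num.truncn (2 `^ (2 `^ (2 `^ x)))).+1%:R <= _).
  by have /andP[_ /ltW] := truncn_itv (powR_ge0 2 (2 `^ (2 `^ x))).
by rewrite ler_nat.
Qed.

Lemma powR_root L (k : nat) : (0 < k)%N -> 0 <= L -> (L `^ (1 / k%:R)) ^+ k = L.
Proof.
move=> k0 L0; rewrite -powR_mulrn ?powR_ge0 // -powRrM.
by rewrite mul1r mulVf ?powRr1 // pnatr_eq0 -lt0n.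
Qed.

Lemma root_le_1D x (k : nat) : (0 < k)%N -> 0 <= x -> x `^ (1 / k%:R) <= 1 + x.
Proof.
move=> k0 x0; have k1 : 1 <= k%:R :> R by rewrite ler1n.
have e1 : 1 / k%:R <= 1 :> R by rewrite ler_pdivrMr; lra.
apply: le_trans (_ : (1 + x) `^ (1 / k%:R) <= _).
  by apply: ge0_ler_powR; rewrite ?nnegrE ?divr_ge0 //; lra.
by apply: ler1_powR => //; lra.
Qed.

(* In terms of [L = log2 d], [y = log2 L], [z = log2 y], the bound on [k] says
   [(y ^ 2) ^ k <= L]; this is what makes the additive [k] in [depth_bound]
   negligible. *)
Lemma depth_small L y z X gamma kap (k t C : nat) :
  (0 < k)%N -> 1 < gamma -> y = expR (ln 2 * z) -> L = expR (ln 2 * y) ->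
  1 <= z -> k%:R <= y / (2 * z) -> 0 < kap -> kap <= 1 -> (0 < C)%N ->
  2 * C%:R / kap <= z -> X = L `^ (1 / k%:R) ->
  t%:R <= kap / (8 * C%:R * (1 + ln 2 / ln gamma)) / k%:R *
    (ln 2 * L / ln gamma) `^ (1 / k%:R) ->
  [/\ y ^+ 2 <= L, k%:R <= y, t%:R <= L &
      ((4 * C * k * (t + k)) ^ k)%:R <= kap * L].
Proof.
move=> k0 gamma1 yE LE z1 k_le kap0 kap1 C0 z_ge XE t_le.
have l2 := @ln2_ge R; have l2' := @ln2_le R.
have lng : 0 < ln gamma by apply: ln_gt0.
have k1 : 1 <= k%:R :> R by rewrite ler1n.
have C1 : 1 <= C%:R :> R by rewrite ler1n.
have kz : 2 * k%:R * z <= y.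
  by move: k_le; rewrite ler_pdivlMr; last lra; lra.
have y1 : 1 <= y by nra.
have L0 : 0 < L by rewrite LE expR_gt0.
have yL : (y ^+ 2) ^+ k <= L.
  rewrite -exprM yE LE -expRM_natr ler_expR -mulrA ler_wpM2l; lra.
have XkE : X ^+ k = L by rewrite XE powR_root // ltW.
have X0 : 0 <= X by rewrite XE powR_ge0.
have y2X : y ^+ 2 <= X.
  by rewrite -(@ler_pXn2r _ k) ?nnegrE ?exprn_ge0 ?XkE //; lra.
have y2_1 : 1 <= y ^+ 2 by rewrite exprn_ege1.
have X1 : 1 <= X by lra.
have XL : X <= L by rewrite -XkE -{1}(expr1 X) ler_weXn2l.
have ky : k%:R <= y by nra.
have kt : 4 * C%:R * k%:R * t%:R <= kap * X / 2.
  have l2g : 0 <= ln 2 / ln gamma by rewrite divr_ge0; lra.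
  have rootE : (ln 2 * L / ln gamma) `^ (1 / k%:R) <= X * (1 + ln 2 / ln gamma).
    have -> : ln 2 * L / ln gamma = L * (ln 2 / ln gamma) by ring.
    rewrite powRM ?(ltW L0) // -XE ler_wpM2l // root_le_1D //.
  have {}t_le : t%:R <= kap / (8 * C%:R * (1 + ln 2 / ln gamma)) / k%:R *
      (X * (1 + ln 2 / ln gamma)).
    apply: le_trans t_le _; rewrite ler_wpM2l // !divr_ge0 ?mulr_ge0 //; lra.
  have -> : kap * X / 2 = 4 * C%:R * k%:R * (kap / (8 * C%:R * (1 + ln 2 / ln gamma)) / k%:R *
      (X * (1 + ln 2 / ln gamma))).
    by field; rewrite !gt_eqF //; lra.
  by rewrite ler_wpM2l // !mulr_ge0 //; lra.
(* From [4 * k ^ 2 * z <= (2 * k * z) ^ 2 <= y ^ 2 <= X], the growing factor [z] pays for the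
   constant [2 * C / kap]. *)
have kk : 4 * C%:R * k%:R ^+ 2 <= kap * X / 2.
  have Cz : 2 * C%:R <= kap * z by move: z_ge; rewrite ler_pdivrMr //; lra.
  have kz2 : 4 * k%:R ^+ 2 * z <= X.
    apply: le_trans y2X; apply: le_trans (_ : (2 * k%:R * z) ^+ 2 <= _).
      by rewrite !exprMn [z ^+ 2]expr2; have : 0 <= k%:R ^+ 2 * z :> R; nra.
    by rewrite ler_pXn2r ?nnegrE ?mulr_ge0 //; lra.
  have k2 : 0 <= k%:R ^+ 2 :> R by rewrite exprn_ge0.
  nra.
split=> //.
- by apply: le_trans yL; rewrite -{1}(expr1 (y ^+ 2)) ler_weXn2l.
- have ck : 1 <= C%:R * k%:R :> R by apply: mulr_ege1.
  have := ler_wpM2r (ler0n R t) ck; have := ler_wpM2r X0 kap1; lra.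
rewrite natrX; apply: le_trans (_ : (kap * X) ^+ k <= _).
  apply: lerXn2r; rewrite ?nnegrE ?mulr_ge0 ?(ltW kap0) //.
  have -> : (4 * C * k * (t + k))%:R = 4 * C%:R * k%:R * t%:R + 4 * C%:R * k%:R ^+ 2 :> R.
    by rewrite !(natrM, natrD); ring.
  lra.
rewrite exprMn XkE ler_wpM2r ?(ltW L0) //.
by rewrite -[leRHS]expr1 ler_wiXn2l // ltW.
Qed.

Lemma sample_budget L y (c lnn : R) (k t w : nat) :
  (0 < k)%N -> 0 < c -> L = expR (ln 2 * y) -> 10 + 4 * c <= y -> y ^+ 2 <= L ->
  k%:R <= y -> t%:R <= L -> w%:R <= expR (c * (ln 2 * L)) -> ln 2 * L ^+ 2 <= lnn ->
  2 <= lnn / (4 * k%:R) /\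
  16 * (16 * k%:R) ^+ 5 * (t%:R * w%:R) <= expR (lnn / (4 * k%:R)).
Proof.
move=> k0 c0 LE y_ge yL ky tL w_le n_ge.
have l2 := @ln2_ge R; have k1 : 1 <= k%:R :> R by rewrite ler1n.
have y0 : 0 < y by lra.
have L0 : 0 < L by rewrite LE expR_gt0.
(* The binary exponent of the budget: [16 * 16 ^ 5 = 2 ^ 24], [k ^ 5 * t <= L ^ 6 = 2 ^ (6 * y)] and
   [w <= d ^ c = 2 ^ (c * L)]. *)
pose e := 24 + 6 * y + c * L.
have cL0 : 0 < c * L by apply: mulr_gt0.
have e24 : 24 <= e by rewrite /e; lra.
have e_le : ln 2 * e <= lnn / (4 * k%:R).
  rewrite ler_pdivlMr; last by lra.
  apply: le_trans n_ge; rewrite -mulrA ler_wpM2l //; first by lra.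
  apply: le_trans (_ : e * (4 * y) <= _); first by rewrite ler_wpM2l //; lra.
  have H1 : y ^+ 2 * L <= L ^+ 2 by rewrite [leRHS]expr2 ler_wpM2r // ltW.
  have H2 : (10 + 4 * c) * (y * L) <= y ^+ 2 * L.
    by rewrite expr2 -[leRHS]mulrA ler_wpM2r // mulr_ge0 // ltW.
  have H3 : y * (10 * y) <= y * L.
    rewrite ler_wpM2l ?(ltW y0) //; apply: le_trans yL.
    by rewrite expr2 ler_wpM2r ?(ltW y0) //; lra.
  have H4 : 10 * y <= y * y by rewrite ler_wpM2r ?(ltW y0) //; lra.
  by rewrite /e; lra.
split.
  by apply: le_trans e_le; have : 1 / 2 * 24 <= ln 2 * e :> R; [apply: ler_pM; lra | lra].
apply: le_trans (_ : expR (ln 2 * e) <= _); last by rewrite ler_expR.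
have two : expR (ln 2) = 2 :> R by apply: lnK; rewrite posrE.
have -> : expR (ln 2 * e) = 2 ^+ 24 * (L ^+ 5 * (L * expR (c * (ln 2 * L)))).
  have -> : ln 2 * e = ln 2 * 24%:R + ln 2 * y * 6%:R + c * (ln 2 * L).
    by rewrite /e; ring.
  by rewrite !expRD !expRM_natr two -LE exprSr !mulrA.
have -> : 16 * (16 * k%:R) ^+ 5 * (t%:R * w%:R) =
    2 ^+ 24 * (k%:R ^+ 5 * (t%:R * w%:R)) :> R.
  have -> : 16 = 2 ^+ 4 :> R by rewrite -natrX.
  by ring.
have kL : k%:R <= L.
  by apply: le_trans ky (le_trans _ yL); rewrite -{1}(expr1 y) ler_weXn2l //; lra.
rewrite ler_wpM2l ?exprn_ge0 //; apply: ler_pM; rewrite ?mulr_ge0 ?exprn_ge0 //.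
  by apply: lerXn2r; rewrite ?nnegrE ?ler0n ?(ltW L0).
by apply: ler_pM; rewrite ?ler0n.
Qed.

Lemma half_le_exp x : 0 <= x -> x / 2 <= expR (ln 2 * x).
Proof.
move=> x0; have := @expR_ge1Dx R (ln 2 * x).
have := ler_wpM2r x0 (@ln2_ge R); lra.
Qed.

Lemma iterated_logs (A : R) (d : nat) : 0 <= A ->
  2000 + 4 * A <= log2 (log2 (log2 d%:R)) ->
  exists z y L : R, [/\ log2 (log2 (log2 d%:R)) = z, log2 (log2 d%:R) = y & log2 d%:R = L] /\
    [/\ y = expR (ln 2 * z), L = expR (ln 2 * y) & d%:R = expR (ln 2 * L)] /\
    [/\ 2000 + A <= z, 1000 + A <= y & 500 + A <= L].
Proof.
move=> A0; set L : R := log2 d%:R; set y := log2 L; set z := log2 y => z_ge.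
have z0 : 0 < z by lra.
have yE := log2_gt0_exp z0.
have y_ge : 1000 + 2 * A <= y.
  by rewrite yE; apply: le_trans (half_le_exp (ltW z0)); rewrite -/z; lra.
have y0 : 0 < y by lra.
have LE := log2_gt0_exp y0.
have L_ge : 500 + A <= L.
  by rewrite LE; apply: le_trans (half_le_exp (ltW y0)); rewrite -/y; lra.
have L0 : 0 < L by lra.
have dE := log2_gt0_exp L0.
by exists z, y, L; split=> //; split=> //; split; lra.
Qed.

Lemma log_size_ge L (n d : nat) : 0 < L -> d%:R = expR (ln 2 * L) ->
  d%:R <= 2 `^ Num.sqrt (log2 n%:R) :> R -> ln 2 * L ^+ 2 <= ln n%:R.
Proof.
move=> L0 dE d_le; have l2 : 0 < ln 2 :> R by have := @ln2_ge R; lra.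
have L_le : L <= Num.sqrt (log2 n%:R).
  have : ln d%:R <= ln (2 `^ Num.sqrt (log2 n%:R)) :> R.
    by rewrite ler_ln ?posrE ?powR_gt0 // dE expR_gt0.
  by rewrite dE expRK ln_powR mulrC ler_pM2r.
have n0 : 0 <= log2 n%:R :> R by rewrite ltW // -sqrtr_gt0 (lt_le_trans L0).
rewrite mulrC -ler_pdivlMr // -[leRHS](sqr_sqrtr n0).
by apply: lerXn2r; rewrite ?nnegrE ?(ltW L0) // sqrtr_ge0.
Qed.

(** [E] is about [d ^ 0.99], enough for [n] code words, and [r ^ D <= d ^ 0.005]. The remaining
    factor [d ^ 0.005] absorbs the [2] lost in rounding. *)
Lemma ambient_dimension L gamma (n d r D : nat) : 1 < gamma ->
  500 + 8 * gamma <= L -> d%:R = expR (ln 2 * L) -> (1 < r)%N ->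
  D%:R <= ln 2 / (200 * ln r%:R) * L ->
  n%:R <= 2 `^ (d%:R `^ (99 / 100)) :> R ->
  exists E : nat, [/\ gamma <= E%:R, (n < 4 ^ E)%N & (E * r ^ D <= d)%N].
Proof.
move=> gamma1 L_ge dE r1 D_le n_le.
have l2L : 1 / 2 * L <= ln 2 * L by rewrite ler_wpM2r ?ln2_ge //; lra.
have lr0 : 0 < ln r%:R :> R by rewrite ln_gt0 // ltr1n.
have dpE : d%:R `^ (99 / 100) = expR (99 / 100 * (ln 2 * L)).
  by rewrite /powR dE expRK gt_eqF // expR_gt0.
set dp : R := d%:R `^ (99 / 100) in dpE n_le.
have dp_ge : gamma + 1 <= dp.
  by rewrite dpE; apply: le_trans (expR_ge1Dx _); lra.
have dp0 : 0 <= dp by lra.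
pose E := (Num.truncn dp).+1; exists E.
have [E_gt E_le] : dp <= E%:R /\ E%:R <= 2 * dp.
  have /andP[H1 H2] := truncn_itv dp0.
  by split; [exact: ltW | rewrite /E -natr1; lra].
split; first by apply: le_trans E_gt; lra.
  apply: leq_ltn_trans (_ : 2 ^ E < _)%N; last by rewrite ltn_exp2r.
  rewrite -(ler_nat R) natrX -powR_mulrn //; apply: le_trans n_le _.
  by apply: ler_powR => //; rewrite ler1n.
rewrite -(ler_nat R) natrM natrX.
have rD : r%:R ^+ D <= expR (ln 2 * L / 200).
  rewrite -[r%:R]lnK ?posrE ?ltr0n ?(ltnW r1) // -expRM_natr ler_expR.
  apply: le_trans (ler_wpM2l (ltW lr0) D_le) _.
  have -> // : ln r%:R * (ln 2 / (200 * ln r%:R) * L) = ln 2 * L / 200.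
  by field; rewrite gt_eqF.
have two : 2 <= expR (ln 2 * L / 200) by apply: le_trans (expR_ge1Dx _); lra.
apply: le_trans (_ : (expR (ln 2 * L / 200) * dp) * expR (ln 2 * L / 200) <= _).
  apply: ler_pM rD => //; rewrite ?exprn_ge0 //.
  by apply: le_trans E_le _; rewrite ler_wpM2r.
rewrite dpE -!expRD dE ler_expR; lra.
Qed.

Lemma branching (n k : nat) (K : R) : (0 < n)%N -> (0 < k)%N ->
  K = expR (ln n%:R / (4 * k%:R)) -> 2 <= ln n%:R / (4 * k%:R) :> R ->
  exists q : nat, (q.+1 ^ k <= n)%N /\ K ^+ 2 / 2 <= q.+1%:R.
Proof.
move=> n0 k0 KE lnK2; have kR0 : 0 < k%:R :> R by rewrite ltr0n.
have K3 : 3 <= K by rewrite KE; apply: le_trans (expR_ge1Dx _); lra.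
have K2 : 9 <= K ^+ 2 by nra.
have K20 : 0 <= K ^+ 2 by lra.
(* The number of children is [K ^ 2 = n ^ (1 / (2 * k))] rounded down, so [k] levels have at most
   [sqrt n] leaves. *)
exists (Num.truncn (K ^+ 2)).-1; rewrite prednK; last by rewrite truncn_gt0; lra.
have /andP[q_le q_gt] := truncn_itv K20; split.
  rewrite -(ler_nat R) natrX; apply: le_trans (_ : (K ^+ 2) ^+ k <= _).
    by apply: lerXn2r; rewrite ?nnegrE.
  rewrite -exprM KE -expRM_natr -[leRHS]lnK ?posrE ?ltr0n // ler_expR natrM.
  have -> : ln n%:R / (4 * k%:R) * (2 * k%:R) = ln n%:R / 2 :> R.
    by field; rewrite gt_eqF.
  have ln_n0 : 0 <= ln n%:R :> R by rewrite ln_ge0 // ler1n.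
  lra.
by move: q_gt; rewrite -natr1; lra.
Qed.

Lemma ln_size_le (s n : nat) (c : R) : (0 < n)%N -> 0 < c -> s%:R <= n%:R `^ c ->
  ln s%:R <= c * ln n%:R.
Proof.
move=> n0 c0 s_le; case: s s_le => [|s] s_le.
  by rewrite ln0 // mulr_ge0 ?(ltW c0) // ln_ge0 // ler1n.
by rewrite -ln_powR ler_ln ?posrE ?ltr0n ?powR_gt0 ?ltr0n.
Qed.

End Asymptotics.

Theorem theorem8 (R : realType) (gamma : R) (hgamma : 1 < gamma)
    (c1 c2 : R) (hc1 : 0 < c1) (hc2 : 0 < c2) :
  exists c3 : R, 0 < c3 /\
  exists N : nat, forall n d : nat,
    (1 <= n)%N -> (1 <= d)%N -> (N <= n)%N -> (N <= d)%N ->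
    d%:R <= 2 `^ Num.sqrt (log2 n%:R) :> R ->
    n%:R <= 2 `^ (d%:R `^ (99 / 100)) :> R ->
    forall k : nat, (1 <= k)%N ->
    k%:R <= log2 (log2 d%:R) / (2 * log2 (log2 (log2 d%:R))) :> R ->
    forall s w t : nat,
    s%:R <= n%:R `^ c1 :> R ->
    w%:R <= d%:R `^ c2 :> R ->
    anns_has_randomized_scheme gamma d n s w k t ->
    c3 / k%:R * (logb gamma d%:R) `^ (1 / k%:R) < t%:R.
Proof.
have l2 := @ln2_ge R; have l2' := @ln2_le R.
pose r := (Num.truncn (8 * gamma + 1)).+1.
have r_ge : 8 * gamma + 1 <= r%:R.
  have /andP[_ /ltW //] := @truncn_itv R (8 * gamma + 1) ltac:(lra).
have r2 : 2 <= r%:R :> R by lra.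
have lr2 : ln 2 <= ln r%:R :> R by rewrite ler_ln ?posrE //; lra.
have lr0 : 0 < ln r%:R :> R by lra.
(* The fraction of [log d] usable as depth: [r ^ (kap * log d) = d ^ (1 / 200)]. *)
pose kap : R := ln 2 / (200 * ln r%:R).
have kap0 : 0 < kap by rewrite divr_gt0 //; lra.
have kap1 : kap <= 1 by rewrite ler_pdivrMr; lra.
pose C := (Num.truncn (128 * c1)).+1.
have C_ge : 128 * c1 <= C%:R.
  have /andP[_ /ltW //] := @truncn_itv R (128 * c1) ltac:(lra).
have lng : 0 < ln gamma by apply: ln_gt0.
have l2g : 0 < ln 2 / ln gamma by rewrite divr_gt0 //; lra.
exists (kap / (8 * C%:R * (1 + ln 2 / ln gamma))); split.
  by rewrite divr_gt0 // !mulr_gt0 ?ltr0n //; lra.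
have Ckap : 0 < 2 * C%:R / kap by rewrite divr_gt0 // mulr_gt0 // ltr0n.
set z0 : R := 2 * C%:R / kap in Ckap.
pose A := z0 + 8 * gamma + 8 * c2.
have A0 : 0 <= A by rewrite /A; lra.
have [A_z0 A_gamma A_c2] : [/\ z0 <= A, 8 * gamma <= A & 8 * c2 <= A].
  by rewrite /A; split; lra.
have [N HN] := log2_unbounded (2000 + 4 * A).
exists N => n d n1 d1 _ /HN.
case/(iterated_logs A0) => z [y [L [[-> -> LE'] [[yE LE dE] [z_ge y_ge L_ge]]]]].
have r1 : (1 < r)%N by rewrite -(ltr1n R); lra.
have C0 : (0 < C)%N by [].
clearbody r C A.
have z1 : 1 <= z by apply: le_trans z_ge; rewrite ler_wpDr //; lra.
have z_z0 : z0 <= z by apply: le_trans z_ge; rewrite ler_wpDl.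
have y_c2 : 10 + 4 * c2 <= y by apply: le_trans y_ge; lra.
have L_gamma : 500 + 8 * gamma <= L by apply: le_trans L_ge; lra.
have L_gt0 : 0 < L by rewrite LE expR_gt0.
move=> d_le n_le k k1 k_le s w t s_le w_le [ts [S [ts_t correct]]].
(* Few probes would make the depth of the tree at most [kap * L], so the hard instances would fit
   into dimension [d]. *)
rewrite ltNge; apply/negP; rewrite /logb dE expRK => t_le.
have [yL ky tL D_le] :=
  depth_small k1 hgamma yE LE z1 k_le kap0 kap1 C0 z_z0 (erefl _) t_le.
have n_ge := log_size_ge L_gt0 dE d_le.
have w_le' : w%:R <= expR (c2 * (ln 2 * L)).
  by move: w_le; rewrite /powR dE expRK gt_eqF // expR_gt0.
have [lnK2 K_big] := sample_budget k1 hc2 LE y_c2 yL ky tL w_le' n_ge.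
have [E [gammaE nE d_ge]] := ambient_dimension hgamma L_gamma dE r1 D_le n_le.
have [q [qk q_ge]] := branching n1 k1 (erefl _) lnK2.
have s_le' := ln_size_le n1 hc1 s_le.
have K0 := expR_gt0 (ln n%:R / (4 * k%:R) : R).
have lnK := expRK (ln n%:R / (4 * k%:R) : R).
have lnK_big := lnK2; rewrite -lnK in lnK_big.
exact: (no_scheme hgamma gammaE r_ge nE k1 qk ts_t C0 d_ge hc1 C_ge K0 lnK lnK_big
  s_le' q_ge K_big correct).
Qed.
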